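(* Suppose that the level set $\Omega=\{x\in\mathbb{R}^n: f(x)\le f(x_0)\}$ is bounded. Let $\varepsilon>0$, let $\delta\in(0,1)$, put $\delta_s:=2\left(\exp(-\frac{\mathcal{C}_0}{4}s)+\exp(-s)\right)$, assume $\delta_s<1$, and define $$m=\left\lfloor \frac{f(x_0)-f^*}{(1-\delta)(1-\delta_s)\,p(\varepsilon)\,\varepsilon^2}\right\rfloor+1,\qquad p(\varepsilon)=\frac{\alpha\, t_{\min}(\varepsilon)}{2\bar{\mathcal{C}}(1+c_1)\frac{n}{s}U_H(\varepsilon)+2c_2U_g^{\gamma}}.$$ Then, with probability at least $1-\exp\left(-\frac{\delta^2}{2}(1-\delta_s)m\right)$, there exists $k\in\{0,1,\dots,m-1\}$ such that $\|g_k\|<\varepsilon$.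
   Context: Algorithm (RS-RNM). $f:\mathbb{R}^n\to\mathbb{R}$ is twice continuously differentiable and $s<n$ is a positive integer. Parameters: $x_0\in\mathbb{R}^n$, $\gamma\ge 0$, $c_1>1$, $c_2>0$, $\alpha,\beta\in(0,1)$. At each iteration $k=0,1,2,\dots$ one independently samples a random matrix $P_k\in\mathbb{R}^{s\times n}$ whose entries are i.i.d. $\mathrm{N}(0,1/s)$. With $g_k=\nabla f(x_k)$, $H_k=\nabla^2 f(x_k)$, set $\Lambda_k=\max(0,-\lambda_{\min}(P_kH_kP_k^\top))$, $\eta_k=c_1\Lambda_k+c_2\|g_k\|^\gamma$, $M_k=P_kH_kP_k^\top+\eta_kI_s$, $d_k=-P_k^\top M_k^{-1}P_kg_k$. Let $l_k\ge 0$ be the smallest integer with $f(x_k)-f(x_k+\beta^{l_k}d_k)\ge -\alpha\beta^{l_k}g_k^\top d_k$ (Armijo's rule), $t_k=\beta^{l_k}$, $x_{k+1}=x_k+t_kd_k$. Norms are Euclidean / spectral. Constants. $\mathcal{C}_0>0$ is an absolute constant such that for every random matrix $P\in\mathbb{R}^{s\times n}$ with i.i.d. $\mathrm{N}(0,1/s)$ entries, every $x\in\mathbb{R}^n$ and $\epsilon\in(0,1)$, $(1-\epsilon)\|x\|^2\le\|Px\|^2\le(1+\epsilon)\|x\|^2$ with probability at least $1-2\exp(-\mathcal{C}_0\epsilon^2 s)$. $\bar{\mathcal{C}}>0$ is a constant such that $\|PP^\top\|\le\bar{\mathcal{C}}\frac{n}{s}$ with probability at least $1-2e^{-s}$. When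 $\Omega$ is bounded: $f^*=\inf_{x\in\Omega}f(x)$; $U_g>0$ is a constant with $\|g_k\|\le U_g$ for all $k\ge0$ (it exists because all iterates lie in $\Omega$); $r(\varepsilon)=\frac{\bar{\mathcal{C}}n}{c_2s}\max\left(U_g^{1-\gamma},\frac{1}{\varepsilon^{\gamma-1}}\right)$; $U_H(\varepsilon)>0$ is a constant with $\|\nabla^2f(x)\|\le U_H(\varepsilon)$ for all $x\in\Omega+B(0,r(\varepsilon))$, where $B(0,r)$ is the ball of radius $r$ centred at $0$; and $$t_{\min}(\varepsilon)=\min\left(1,\frac{2(1-\alpha)\beta c_2^2\varepsilon^{2\gamma}s}{\left((1+c_1)\frac{\bar{\mathcal{C}}n}{s}U_H(\varepsilon)+c_2U_g^{\gamma}\right)U_H(\varepsilon)\bar{\mathcal{C}}n}\right).$$ *)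

(* Defs.v *)
From HB Require Import structures.
From mathcomp Require Import all_boot all_order all_algebra.
From mathcomp Require Import all_classical all_reals all_analysis.

Set Implicit Arguments.
Unset Strict Implicit.
Unset Printing Implicit Defensive.

Import Order.TTheory GRing.Theory Num.Theory.
Import numFieldNormedType.Exports.

Local Open Scope classical_set_scope.
Local Open Scope ring_scope.

Section LinearAlgebra.
Context {R : realType}.

(* The library norm `|v| on matrices is the maximum norm, hence [norm2]. *)
Definition norm2 n (v : 'cV[R]_n) : R := Num.sqrt (\sum_i v i 0 ^+ 2).

Definition spectral_norm m n (A : 'M[R]_(m, n)) : R :=
  sup [set norm2 (A *m v) | v in [set v : 'cV[R]_n | norm2 v <= 1]].

(* Only used for symmetric matrices of positive size, whose set of real
   eigenvalues is finite and nonempty, so that the infimum is a minimum. *)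
Definition lambda_min n (A : 'M[R]_n) : R := inf [set a | eigenvalue A a].

End LinearAlgebra.

Section Calculus.
Context {R : realType} {n : nat}.
Implicit Types (f : 'cV[R]_n -> R) (x : 'cV[R]_n).

Definition grad f x : 'cV[R]_n := \col_i 'D_(delta_mx i 0) f x.

Definition hess f x : 'M[R]_n :=
  \matrix_(i, j) 'D_(delta_mx j 0) (fun y => grad f y i 0) x.

Definition twice_continuously_differentiable f : Prop :=
  [/\ forall x, differentiable f x,
      forall x, differentiable (grad f) x
    & continuous (hess f)].

Definition level_set f x0 : set 'cV[R]_n := [set x | f x <= f x0].

End Calculus.

Section Probability.
Context {R : realType}.

Definition mutually_independent d (T : measurableType d) (Pr : probability T R)
    (I : eqType) (X : I -> {RV Pr >-> R}) : Prop :=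
  forall (J : seq I) (B : I -> set R), uniq J ->
    (forall i, measurable (B i)) ->
    (Pr (\big[setI/setT]_(i <- J) (X i @^-1` B i)) =
     \prod_(i <- J) Pr (X i @^-1` B i))%E.

(* [normal_prob] takes the standard deviation, not the variance. *)
Definition iid_centered_normal d (T : measurableType d) (Pr : probability T R)
    (v : R) (I : eqType) (X : I -> {RV Pr >-> R}) : Prop :=
  mutually_independent X /\
  forall i (B : set R), measurable B ->
    Pr (X i @^-1` B) = normal_prob 0 (Num.sqrt v) B.

Definition random_mx d (T : measurableType d) (Pr : probability T R) s n
    (X : 'I_s * 'I_n -> {RV Pr >-> R}) (w : T) : 'M[R]_(s, n) :=
  \matrix_(i, j) X (i, j) w.

Definition jl_constant (C0 : R) : Prop :=
  0 < C0 /\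
  forall (s n : nat) d (T : measurableType d) (Pr : probability T R)
    (X : 'I_s * 'I_n -> {RV Pr >-> R}),
    (0 < s)%N -> iid_centered_normal s%:R^-1 X ->
    forall (x : 'cV[R]_n) (eps : R), 0 < eps < 1 ->
      ((1 - 2 * expR (- (C0 * eps ^+ 2 * s%:R)))%:E <=
       Pr [set w | ((1 - eps) * norm2 x ^+ 2
                     <= norm2 (random_mx X w *m x) ^+ 2
                     <= (1 + eps) * norm2 x ^+ 2)%R])%E.

Definition gram_constant (s n : nat) (C : R) : Prop :=
  0 < C /\
  forall d (T : measurableType d) (Pr : probability T R)
    (X : 'I_s * 'I_n -> {RV Pr >-> R}),
    iid_centered_normal s%:R^-1 X ->
    ((1 - 2 * expR (- s%:R))%:E <=
     Pr [set w | (spectral_norm (random_mx X w *m (random_mx X w)^T)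
                    <= C * (n%:R / s%:R))%R])%E.

End Probability.

Section Algorithm.
Context {R : realType} {s n : nat}.
Variables (f : 'cV[R]_n -> R) (gamma c1 c2 alpha beta : R).
Implicit Types (P : 'M[R]_(s, n)) (x d : 'cV[R]_n).

Definition sketched_hess P x : 'M[R]_s := P *m hess f x *m P^T.

Definition Lambda P x : R := Num.max 0 (- lambda_min (sketched_hess P x)).

Definition eta_reg P x : R := c1 * Lambda P x + c2 * norm2 (grad f x) `^ gamma.

Definition reg_hess P x : 'M[R]_s := sketched_hess P x + (eta_reg P x)%:M.

(* [reg_hess P x] can only be singular when [grad f x = 0]; then the direction
   is 0 whatever value [invmx] takes, and the iteration stays at [x]. *)
Definition direction P x : 'cV[R]_n :=
  - (P^T *m invmx (reg_hess P x) *m P *m grad f x).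

Definition armijo x d (l : nat) : Prop :=
  f x - f (x + beta ^+ l *: d)
    >= - alpha * beta ^+ l * ((grad f x)^T *m d) 0 0.

(* The default value 0 is never used for [d = direction P x]: [d] is then 0 or
   a descent direction, so some exponent satisfies [armijo]. *)
Definition armijo_exponent x d : nat :=
  xget 0%N [set l | armijo x d l /\ forall j, armijo x d j -> (l <= j)%N].

Definition next_iterate P x : 'cV[R]_n :=
  let d := direction P x in x + beta ^+ armijo_exponent x d *: d.

Fixpoint iterate (P_ : nat -> 'M[R]_(s, n)) x0 (k : nat) : 'cV[R]_n :=
  if k is k'.+1 then next_iterate (P_ k') (iterate P_ x0 k') else x0.

End Algorithm.

Section Constants.
Context {R : realType}.
Variables (s n : nat) (gamma c1 c2 alpha beta C Ug UH eps : R).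

Definition r_eps : R :=
  C * n%:R / (c2 * s%:R) *
  Num.max (Ug `^ (1 - gamma)) (1 / eps `^ (gamma - 1)).

Definition t_min : R :=
  Num.min 1
    (2 * (1 - alpha) * beta * c2 ^+ 2 * eps `^ (2 * gamma) * s%:R /
     (((1 + c1) * (C * n%:R / s%:R) * UH + c2 * Ug `^ gamma)
      * UH * C * n%:R)).

Definition p_eps : R :=
  alpha * t_min /
  (2 * C * (1 + c1) * (n%:R / s%:R) * UH + 2 * c2 * Ug `^ gamma).

End Constants.

Definition delta_s {R : realType} (C0 : R) (s : nat) : R :=
  2 * (expR (- (C0 / 4 * s%:R)) + expR (- s%:R)).

(* Main.v *)
Require Import Defs.
From mathcomp Require Import all_boot all_order all_algebra.
From mathcomp Require Import all_classical all_reals all_analysis.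
From mathcomp Require Import measurable_realfun.
From mathcomp Require Import ring lra.

(** Call iteration [k] good when its sketch [P_k] satisfies
    [|P_k g_k|^2 >= |g_k|^2 / 2] and [|P_k P_k^T| <= C n / s].

    Deterministic part. Suppose that [|g_k| >= eps] and that iteration [k] is
    good. The regularized matrix [M_k] lies between [c2 |g_k|^gamma] and
    [L = (1 + c1) (C n / s) UH + c2 Ug^gamma] as a quadratic form. The lower
    bound limits the length of [d_k] by [r_eps], so that the Hessian is bounded
    by [UH] on the whole search segment; the upper bound gives
    [- g_k^T d_k >= |P_k g_k|^2 / L]. Taylor's formula then shows that Armijo's
    rule accepts every step below a threshold, so that backtracking stops above
    [t_min] and [f] decreases by at least [p_eps * eps^2]
    ([sufficient_decrease]). In every iteration, good or not, [f] does not
    increase ([next_iterate_le]). If no gradient among the first [m] is smaller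
    than [eps], the number of good iterations is therefore at most
    [(f x0 - inf f) / (p_eps * eps^2)], the infimum being over the level set;
    this is less than
    [(1 - delta) (1 - delta_s) m] by the choice of [m].

    Probabilistic part. The gradient [g_k] is a function of the sketches before
    [k] and [P_k] is independent of them, so iteration [k] is good with
    probability at least [1 - delta_s] given any event of the past
    ([good_step_conditional]). A Chernoff bound that needs only such
    conditional estimates ([chernoff_hits]) shows that fewer than
    [(1 - delta) (1 - delta_s) m] good iterations occur with probability at
    most [exp (- delta^2 / 2 * (1 - delta_s) m)].

    The conditional estimate rests on two facts. Disjoint blocks of independent
    variables generate independent sigma-algebras, by the pi-lambda theorem
    ([independent_blocks]). A vector known to the past can be replaced by a
    constant when estimating a probability that involves the current sketch
    ([freezing]). Conditional expectations and product measures are avoided by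
    approximating the vector by vectors with countably many values. All events
    have to be measurable, which is proved by following the algorithm through
    each of its operations; least eigenvalues and spectral norms are reached
    through inequalities tested on rational vectors. On the analytic side, the
    least eigenvalue is handled as the minimum of the Rayleigh quotient
    ([lambda_min_attained]) and the symmetry of the Hessian is Schwarz's
    theorem ([hess_sym]). *)

Set Implicit Arguments.
Unset Strict Implicit.
Unset Printing Implicit Defensive.
Import Order.TTheory GRing.Theory Num.Theory.
Import numFieldNormedType.Exports.
Local Open Scope classical_set_scope.
Local Open Scope ring_scope.

(** * Inner product and quadratic forms *)

Section QuadraticForms.
Context {R : realType}.

Definition dot n (u v : 'cV[R]_n) : R := (u^T *m v) 0 0.

Lemma dotE n (u v : 'cV[R]_n) : dot u v = \sum_i u i 0 * v i 0.
Proof. by rewrite /dot mxE; apply: eq_bigr => i _; rewrite mxE. Qed.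

Lemma dotC n (u v : 'cV[R]_n) : dot u v = dot v u.
Proof. by rewrite !dotE; apply: eq_bigr => i _; rewrite mulrC. Qed.

Lemma dotDr n (u v w : 'cV[R]_n) : dot u (v + w) = dot u v + dot u w.
Proof. by rewrite /dot mulmxDr mxE. Qed.

Lemma dotZr n a (u v : 'cV[R]_n) : dot u (a *: v) = a * dot u v.
Proof. by rewrite /dot -scalemxAr mxE. Qed.

Lemma dotNr n (u v : 'cV[R]_n) : dot u (- v) = - dot u v.
Proof. by rewrite -scaleN1r dotZr mulN1r. Qed.

Lemma dotDl n (u v w : 'cV[R]_n) : dot (v + w) u = dot v u + dot w u.
Proof. by rewrite dotC dotDr !(dotC u). Qed.

Lemma dotZl n a (u v : 'cV[R]_n) : dot (a *: v) u = a * dot v u.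
Proof. by rewrite dotC dotZr dotC. Qed.

Lemma dot0r n (u : 'cV[R]_n) : dot u 0 = 0.
Proof. by rewrite /dot mulmx0 mxE. Qed.

Lemma dot_mulmx m n (A : 'M[R]_(m, n)) u v : dot u (A *m v) = dot (A^T *m u) v.
Proof. by rewrite /dot trmx_mul trmxK mulmxA. Qed.

Lemma dot_ge0 n (v : 'cV[R]_n) : 0 <= dot v v.
Proof. by rewrite dotE sumr_ge0// => i _; rewrite -expr2 sqr_ge0. Qed.

Lemma dot_eq0 n (v : 'cV[R]_n) : dot v v = 0 -> v = 0.
Proof.
move=> /eqP; rewrite dotE psumr_eq0; last by move=> i _; rewrite -expr2 sqr_ge0.
move=> /allP v0; apply/matrixP => i j; rewrite ord1 mxE.
by have := v0 i (mem_index_enum _); rewrite /= mulf_eq0 orbb => /eqP.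
Qed.

Lemma norm2E n (v : 'cV[R]_n) : norm2 v = Num.sqrt (dot v v).
Proof. by rewrite /norm2 dotE. Qed.

Lemma norm2_sqr n (v : 'cV[R]_n) : norm2 v ^+ 2 = dot v v.
Proof. by rewrite norm2E sqr_sqrtr// dot_ge0. Qed.

Lemma norm2_ge0 n (v : 'cV[R]_n) : 0 <= norm2 v.
Proof. exact: sqrtr_ge0. Qed.

Lemma norm2_eq0 n (v : 'cV[R]_n) : norm2 v = 0 -> v = 0.
Proof. by move=> v0; apply: dot_eq0; rewrite -norm2_sqr v0 expr0n. Qed.

Lemma norm20 n : norm2 (0 : 'cV[R]_n) = 0.
Proof. by rewrite norm2E dot0r sqrtr0. Qed.

Lemma norm2Z n a (v : 'cV[R]_n) : norm2 (a *: v) = `|a| * norm2 v.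
Proof.
by rewrite !norm2E dotZl dotZr mulrA -expr2 sqrtrM ?sqr_ge0// sqrtr_sqr.
Qed.

Lemma norm2N n (v : 'cV[R]_n) : norm2 (- v) = norm2 v.
Proof. by rewrite -scaleN1r norm2Z normrN1 mul1r. Qed.

Lemma norm2_le n (v : 'cV[R]_n) c : 0 <= c -> (norm2 v <= c) = (dot v v <= c ^+ 2).
Proof. by move=> c0; rewrite -norm2_sqr ler_pXn2r ?nnegrE ?norm2_ge0. Qed.

Lemma discriminant_le0 (a b c : R) :
  (forall t, 0 <= a + 2 * b * t + c * t ^+ 2) -> b ^+ 2 <= a * c.
Proof.
move=> h; have a0 : 0 <= a by have := h 0; rewrite mulr0 expr0n mulr0 !addr0.
have [c0|c0|c0] := ltrgt0P c.
- have := h (- b / c); rewrite -(@ler_pM2r _ c)// mul0r.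
  suff -> : (a + 2 * b * (- b / c) + c * (- b / c) ^+ 2) * c = a * c - b ^+ 2.
    by rewrite subr_ge0.
  by field; rewrite gt_eqF.
- (* averaging the values at [t] and [- t] leaves a + c t^2 *)
  set t := 1 - (1 + a) / c.
  have t1 : 1 <= t by rewrite lerDl oppr_ge0 ler_ndivrMr// mul0r; lra.
  have tc : c * t = c - (1 + a) by rewrite /t; field; rewrite lt_eqF.
  have := h t; have := h (- t); nra.
- rewrite c0 mulr0; have [->|b0] := eqVneq b 0; first by rewrite expr0n lexx.
  have := h (- (1 + a) / 2 / b); rewrite c0 mul0r addr0.
  have -> : a + 2 * b * (- (1 + a) / 2 / b) = - 1 by field.
  by rewrite oppr_ge0 ler10.
Qed.

(** The form is nonnegative on the line [u + t *: v], which makes it a quadratic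
    polynomial in [t] without sign change. *)
Lemma psd_cauchy_schwarz n (A : 'M[R]_n) : A^T = A ->
  (forall v, 0 <= dot v (A *m v)) ->
  forall u v, dot u (A *m v) ^+ 2 <= dot u (A *m u) * dot v (A *m v).
Proof.
move=> AT A0 u v; apply: discriminant_le0 => t.
have := A0 (u + t *: v); congr (0 <= _).
rewrite mulmxDr -scalemxAr !(dotDr, dotDl, dotZl, dotZr).
have -> : dot v (A *m u) = dot u (A *m v) by rewrite dot_mulmx AT dotC.
by ring.
Qed.

Lemma cauchy_schwarz n (u v : 'cV[R]_n) : `|dot u v| <= norm2 u * norm2 v.
Proof.
have /= := @psd_cauchy_schwarz n 1%:M (trmx1 _ _) _ u v.
rewrite !mul1mx => h.
have {}h : dot u v ^+ 2 <= dot u u * dot v v.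
  by apply: h => w; rewrite mul1mx dot_ge0.
rewrite -ler_sqr ?nnegrE ?mulr_ge0 ?norm2_ge0//.
by rewrite real_normK ?num_real// exprMn !norm2_sqr.
Qed.

Lemma norm2_coord n (v : 'cV[R]_n) i : `|v i 0| <= norm2 v.
Proof.
rewrite -ler_sqr ?nnegrE ?norm2_ge0// real_normK ?num_real// norm2_sqr dotE.
rewrite (bigD1 i)//= -expr2 lerDl sumr_ge0// => j _.
by rewrite -expr2 sqr_ge0.
Qed.

Lemma mx_norm_le_norm2 n (v : 'cV[R]_n) : `|v| <= norm2 v.
Proof.
rewrite [leLHS]/Num.norm /= mx_normrE; apply/bigmax_leP; split; first exact: norm2_ge0.
by move=> [i j] _ /=; rewrite ord1 norm2_coord.
Qed.

End QuadraticForms.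

(** * Topology of matrix spaces *)

Section MatrixTopology.
Context {R : realType}.

Lemma cvg_mx (T : Type) (F : set_system T) {FF : Filter F} m n
    (g : T -> 'M[R]_(m, n)) (M : 'M[R]_(m, n)) :
  (forall i j, g x i j @[x --> F] --> M i j) -> g x @[x --> F] --> M.
Proof.
move=> h A [P MP PA].
change (F (fun x => A (g x))).
apply: (@filterS _ F _ (fun x => forall i j, P i j (g x i j))).
  by move=> x Px; apply: PA => i j; exact: Px.
by apply: filter_forall => i; apply: filter_forall => j; exact: (h i j _ (MP i j)).
Qed.

Lemma trmx_continuous m n : continuous (@trmx R m n).
Proof.
move=> M; apply: (@cvg_mx _ (nbhs M)) => i j; rewrite mxE.
under eq_fun do rewrite mxE.
exact: coord_continuous.
Qed.

Lemma bounded_closed_compact_cV n (A : set 'cV[R]_n) :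
  bounded_set A -> closed A -> compact A.
Proof.
move=> bA cA; have -> : A = trmx @` [set u : 'rV[R]_n | A u^T].
  by apply/seteqP; split=> [v Av|_ [u /= Au <-]//]; exists v^T => /=; rewrite trmxK.
apply: continuous_compact.
  by apply: continuous_subspaceT; exact: trmx_continuous.
apply: bounded_closed_compact; last first.
  by apply: preimage_closed => // u _; exact: trmx_continuous.
case: bA => M [Mr MA]; exists M; split=> // x Mx u Au /=.
have <- : `|u^T| = `|u|; last exact: MA.
rewrite /Num.norm /= !mx_normrE; apply/le_anti/andP; split.
  apply/bigmax_leP; split; first by apply/bigmax_geP; left.
  move=> [i j] _ /=; rewrite mxE; apply/bigmax_geP; right.
  by exists (j, i).
apply/bigmax_leP; split; first by apply/bigmax_geP; left.
move=> [i j] _ /=; apply/bigmax_geP; right.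
by exists (j, i) => //=; rewrite mxE.
Qed.

(** Neighbourhoods of matrices are products of neighbourhoods of the entries, so
    the density of the rationals can be used entry by entry. *)
Lemma nbhs_rat_mx m n (M : 'M[R]_(m, n)) (U : set 'M[R]_(m, n)) :
  nbhs M U -> exists q : 'M[rat]_(m, n), U (map_mx ratr q).
Proof.
move=> [P MP PU].
have h (ij : 'I_m * 'I_n) : exists q : rat, P ij.1 ij.2 (ratr q).
  have /nbhs_interior := MP ij.1 ij.2; case: ij => i j /=.
  move=> PM; have [|r [Pr [q _ qr]]] := @dense_rat R (P i j)° _ (@open_interior _ _).
    by exists (M i j); exact: nbhs_singleton.
  by exists q; rewrite qr; exact: interior_subset.
have [q hq] := choice h.
exists (\matrix_(i, j) q (i, j)); apply: PU => i j.
by rewrite !mxE; exact: (hq (i, j)).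
Qed.

Lemma sum_continuous (T : topologicalType) (I : finType) (F : I -> T -> R) :
  (forall i, continuous (F i)) -> continuous (fun x => \sum_i F i x).
Proof.
move=> cF; rewrite -[fun _ => _]/(fun x => \sum_(i <- index_enum I) F i x).
elim: (index_enum I) => [|i r ih] x.
  by under eq_fun do rewrite big_nil; exact: cvg_cst.
under eq_fun do rewrite big_cons.
by apply: cvgD; [exact: cF|exact: ih].
Qed.

Lemma dot_continuous (T : topologicalType) n (F G : T -> 'cV[R]_n) :
  continuous F -> continuous G -> continuous (fun x => dot (F x) (G x)).
Proof.
move=> cF cG; under eq_fun do rewrite dotE.
apply: sum_continuous => i x.
have co (H : T -> 'cV[R]_n) : continuous H -> {for x, continuous (fun y => H y i 0)}.
  by move=> cH; apply: (@continuous_comp _ _ _ H (fun M : 'cV[R]_n => M i 0));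
      [exact: cH|exact: coord_continuous].
by apply: cvgM; exact: co.
Qed.

Lemma mulmx_continuous m n (A : 'M[R]_(m, n)) :
  continuous (fun v : 'cV[R]_n => A *m v).
Proof.
move=> v; apply: (@cvg_mx _ (nbhs v)) => i j; rewrite mxE.
under eq_fun do rewrite mxE.
apply: (@sum_continuous _ _ (fun k (u : 'cV[R]_n) => A i k * u k j)) => k u.
by apply: (@cvgM _ _ (nbhs u)); [exact: cvg_cst|exact: coord_continuous].
Qed.

(** A strict reverse inequality would hold on an open set, hence at some
    rational vector. This turns conditions on all vectors into countably many
    conditions, as measurability requires. *)
Lemma le_continuous_rat n (F G : 'cV[R]_n -> R) :
  continuous F -> continuous G ->
  (forall q : 'cV[rat]_n, F (map_mx ratr q) <= G (map_mx ratr q)) ->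
  forall v, F v <= G v.
Proof.
move=> cF cG h v; rewrite leNgt; apply/negP => GF.
have /nbhs_rat_mx[q] : nbhs v [set u | G u < F u].
  have : nbhs v [set u | 0 < F u - G u].
    have c := @cvgB _ _ _ _ _ _ _ _ _ (cF v) (cG v).
    by apply: (c _ [set r | 0 < r]); apply: lt_nbhsr; rewrite subr_gt0.
  by apply: filterS => u /=; rewrite subr_gt0.
by rewrite /= ltNge h.
Qed.

End MatrixTopology.

(** * Spectral norm and least eigenvalue *)

Section Spectrum.
Context {R : realType}.

Lemma norm2_mulmx_bounded m n (A : 'M[R]_(m, n)) :
  exists2 K, 0 <= K & forall v, norm2 (A *m v) <= K * norm2 v.
Proof.
exists (Num.sqrt (\sum_i norm2 (row i A)^T ^+ 2)); first exact: sqrtr_ge0.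
move=> v; rewrite norm2_le ?mulr_ge0 ?sqrtr_ge0 ?norm2_ge0//.
rewrite exprMn sqr_sqrtr; last by rewrite sumr_ge0// => i _; rewrite sqr_ge0.
rewrite dotE mulr_suml; apply: ler_sum => i _.
have -> : (A *m v) i 0 = dot (row i A)^T v.
  by rewrite /dot trmxK -row_mul [RHS]mxE.
have := cauchy_schwarz (row i A)^T v; set a := dot _ _ => h.
by rewrite -expr2 -exprMn -[leLHS](real_normK (num_real _)) ler_pXn2r// nnegrE
  ?mulr_ge0 ?norm2_ge0.
Qed.

Lemma norm2_mulmx m n (A : 'M[R]_(m, n)) v :
  norm2 (A *m v) <= spectral_norm A * norm2 v.
Proof.
have [K K0 hK] := norm2_mulmx_bounded A.
have ub : has_ubound [set norm2 (A *m v) | v in [set v : 'cV[R]_n | norm2 v <= 1]].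
  exists K => _ [u /= u1 <-]; apply: le_trans (hK u) _.
  by rewrite ler_piMr.
have [v0|v0] := eqVneq (norm2 v) 0.
  by rewrite (norm2_eq0 v0) mulmx0 !norm20 mulr0.
have vp : 0 < norm2 v by rewrite lt_neqAle eq_sym v0 norm2_ge0.
rewrite -ler_pdivrMr//; apply: (ub_le_sup ub); exists ((norm2 v)^-1 *: v) => /=.
  by rewrite norm2Z ger0_norm ?invr_ge0 ?norm2_ge0// mulVf.
by rewrite -scalemxAr norm2Z ger0_norm ?invr_ge0 ?norm2_ge0// mulrC.
Qed.

Lemma spectral_norm_leP m n (A : 'M[R]_(m, n)) c : 0 <= c ->
  spectral_norm A <= c <-> forall v, norm2 (A *m v) <= c * norm2 v.
Proof.
move=> c0; split=> [Ac v|h].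
  by apply: le_trans (norm2_mulmx A v) _; rewrite ler_wpM2r ?norm2_ge0.
apply: ge_sup; first by exists (norm2 (A *m 0)), 0 => //=; rewrite norm20.
by move=> _ [v /= v1 <-]; apply: le_trans (h v) _; rewrite ler_piMr.
Qed.

Lemma quad_form_le n (A : 'M[R]_n) c v : spectral_norm A <= c ->
  `|dot v (A *m v)| <= c * dot v v.
Proof.
move=> Ac; apply: le_trans (cauchy_schwarz _ _) _.
rewrite -norm2_sqr expr2 mulrCA ler_wpM2l ?norm2_ge0//.
apply: le_trans (norm2_mulmx A v) _.
by rewrite ler_wpM2r ?norm2_ge0.
Qed.

(** The minimum of the Rayleigh quotient over the (compact) unit sphere is an
    eigenvalue: subtracting it leaves a positive semidefinite form that vanishes
    at the minimizer [v], and Cauchy-Schwarz for that form makes [v] a kernel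
    vector. This avoids diagonalizing the matrix. *)
Lemma lambda_min_attained n (A : 'M[R]_n) : (0 < n)%N -> A^T = A ->
  (forall v, lambda_min A * dot v v <= dot v (A *m v)) /\
  exists2 v, dot v v = 1 & dot v (A *m v) = lambda_min A.
Proof.
move=> n0 AT; pose S := [set v : 'cV[R]_n | dot v v = 1].
have cid : continuous (fun v : 'cV[R]_n => v) by move=> v; exact: cvg_id.
have Sne : S !=set0.
  exists (delta_mx (Ordinal n0) 0); rewrite /S /= dotE (bigD1 (Ordinal n0))//= big1.
    by rewrite !mxE !eqxx mulr1 addr0.
  by move=> i ii; rewrite mxE (negbTE ii) mul0r.
have cS : compact S.
  apply: bounded_closed_compact_cV.
    exists 1; split; first exact: num_real.
    move=> x x1 v Sv; apply: le_trans (mx_norm_le_norm2 v) _.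
    by rewrite norm2E Sv sqrtr1 ltW.
  apply: (@preimage_closed _ _ (fun v : 'cV[R]_n => dot v v) [set x | x = 1]).
    by move=> v _; exact: dot_continuous.
  exact: closed_eq.
have [|v + vmin] := compact_EVT_min Sne cS (f := fun v => dot v (A *m v)).
  apply: continuous_subspaceT.
  by apply: dot_continuous => //; exact: mulmx_continuous.
rewrite inE => Sv; set mu := dot v (A *m v).
have ray u : mu * dot u u <= dot u (A *m u).
  have [u0|u0] := eqVneq (norm2 u) 0.
    by rewrite (norm2_eq0 u0) mulmx0 !dot0r mulr0.
  have up : 0 < norm2 u by rewrite lt_neqAle eq_sym u0 norm2_ge0.
  have := vmin ((norm2 u)^-1 *: u); rewrite inE /S /= -/mu -scalemxAr !dotZr !dotZl.
  rewrite mulrA -expr2 -norm2_sqr -exprMn mulVf// expr1n => /(_ erefl).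
  by rewrite mulrA -expr2 exprVn mulrC ler_pdivlMr// exprn_gt0.
have vA : A *m v = mu *: v.
  pose B := A - mu%:M.
  have BT : B^T = B by rewrite /B linearB /= AT tr_scalar_mx.
  have BE u : B *m u = A *m u - mu *: u by rewrite /B mulmxBl mul_scalar_mx.
  have Bpsd u : 0 <= dot u (B *m u) by rewrite BE dotDr dotNr dotZr subr_ge0 ray.
  have := psd_cauchy_schwarz BT Bpsd (B *m v) v.
  have -> : dot v (B *m v) = 0 by rewrite BE dotDr dotNr dotZr Sv mulr1 subrr.
  rewrite mulr0 => h.
  have /eqP : dot (B *m v) (B *m v) ^+ 2 = 0.
    by apply/le_anti; rewrite h sqr_ge0.
  by rewrite expf_eq0 /= => /eqP/dot_eq0; rewrite BE => /eqP; rewrite subr_eq0 => /eqP.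
have vn0 : v != 0.
  by apply/eqP => v0; move: Sv; rewrite /S /= v0 dot0r => /esym/eqP; rewrite oner_eq0.
have emu : eigenvalue A mu.
  apply/eigenvalueP; exists v^T; last by rewrite trmx_eq0.
  by rewrite -[in LHS]AT -trmx_mul vA linearZ.
have lbmu : lbound [set a | eigenvalue A a] mu.
  move=> a /= /eigenvalueP[w wA w0].
  have wA' : A *m w^T = a *: w^T by rewrite -[in LHS]AT -trmx_mul wA linearZ.
  have := ray w^T; rewrite wA' dotZr ler_pM2r// lt_neqAle dot_ge0 andbT eq_sym.
  by apply: contra w0 => /eqP/dot_eq0/eqP; rewrite trmx_eq0.
have -> : lambda_min A = mu.
  apply/le_anti/andP; split.
    by apply: ge_inf => //; exists mu.
  by apply: lb_le_inf => //; exists mu.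
by split=> //; exists v.
Qed.

Lemma lambda_min_geP n (A : 'M[R]_n) c : (0 < n)%N -> A^T = A ->
  c <= lambda_min A <-> forall v, c * dot v v <= dot v (A *m v).
Proof.
move=> n0 AT; have [ray [v v1 vmin]] := lambda_min_attained n0 AT.
split=> [h u|h]; last by rewrite -vmin -[c]mulr1 -v1.
by apply: le_trans (ray u); rewrite ler_wpM2r ?dot_ge0.
Qed.

Lemma pd_unitmx n (M : 'M[R]_n) a : 0 < a ->
  (forall v, a * dot v v <= dot v (M *m v)) -> M \in unitmx.
Proof.
move=> a0 Ma; rewrite -unitmx_tr -row_free_unit; apply: inj_row_free => v vM.
have Mv : M *m v^T = 0 by rewrite -[M]trmxK -trmx_mul vM trmx0.
have := Ma v^T; rewrite Mv dot0r pmulr_rle0// => v0.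
have /dot_eq0 : dot v^T v^T = 0 by apply/le_anti; rewrite v0 dot_ge0.
by move/(congr1 trmx); rewrite trmxK trmx0.
Qed.

(** With [u] the solution, [a * |u|^2 <= u^T M u = u^T w <= |u| |w|]. *)
Lemma pd_solve_le n (M : 'M[R]_n) a w : 0 < a ->
  (forall v, a * dot v v <= dot v (M *m v)) ->
  norm2 (invmx M *m w) <= norm2 w / a.
Proof.
move=> a0 Ma; have uM := pd_unitmx a0 Ma; set u := _ *m w.
have Mu : M *m u = w by rewrite mulKVmx.
have [u0|u0] := eqVneq (norm2 u) 0; first by rewrite u0 divr_ge0 ?norm2_ge0 ?ltW.
have up : 0 < norm2 u by rewrite lt_neqAle eq_sym u0 norm2_ge0.
rewrite ler_pdivlMr// -(ler_pM2l up) mulrA -expr2 norm2_sqr mulrC.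
apply: le_trans (Ma u) _; rewrite Mu.
exact: le_trans (ler_norm _) (cauchy_schwarz _ _).
Qed.

(** Cauchy-Schwarz for the form [M], applied to [M u] and [u] where [M u = w]. *)
Lemma pd_solve_ge n (M : 'M[R]_n) a L w : 0 < a -> 0 < L -> M^T = M ->
  (forall v, a * dot v v <= dot v (M *m v)) ->
  (forall v, dot v (M *m v) <= L * dot v v) ->
  norm2 w ^+ 2 / L <= dot w (invmx M *m w).
Proof.
move=> a0 L0 MT Ma ML; have uM := pd_unitmx a0 Ma; set u := _ *m w.
have Mu : M *m u = w by rewrite mulKVmx.
have Mpsd v : 0 <= dot v (M *m v).
  by apply: le_trans (Ma v); rewrite mulr_ge0 ?dot_ge0 ?ltW.
have := psd_cauchy_schwarz MT Mpsd w u.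
rewrite Mu (dotC u) norm2_sqr => h.
have wu0 : 0 <= dot w u by have := Mpsd u; rewrite Mu dotC.
rewrite ler_pdivrMr//; have [->|w0] := eqVneq (dot w w) 0.
  by rewrite mulr_ge0// ltW.
have wp : 0 < dot w w by rewrite lt_neqAle eq_sym w0 dot_ge0.
rewrite -(ler_pM2l wp) -expr2; apply: le_trans h _.
by rewrite [leRHS]mulrCA [leRHS]mulrC [dot w w * L]mulrC ler_wpM2r.
Qed.

End Spectrum.

(** * Second-order calculus *)

Section Calculus.
Context {R : realType}.

(** Along a line the difference quotient of the restriction is literally the
    directional difference quotient. *)
Lemma is_derive_line n (F : 'cV[R]_n -> R) x v t :
  derivable F (x + t *: v) v ->
  is_derive t 1 (fun u => F (x + u *: v)) ('D_v F (x + t *: v)).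
Proof.
have E : (fun h : R => h^-1 *: (F (h *: v + (x + t *: v)) - F (x + t *: v)))
  = (fun h => h^-1 *: (F (x + (h *: 1 + t) *: v) - F (x + t *: v))).
  by apply/funext => h; rewrite scalerDl addrCA [h%:A]mulr1.
by move=> dF; split; rewrite /derivable /derive /=; rewrite -E.
Qed.

Lemma derive_grad n (f : 'cV[R]_n -> R) x v :
  differentiable f x -> 'D_v f x = dot (grad f x) v.
Proof.
move=> df; rewrite deriveE// {1}(matrix_sum_delta v) dotE.
under eq_bigr do rewrite big_ord1.
rewrite linear_sum; apply: eq_bigr => i _.
by rewrite linearZ mulrC mxE deriveE.
Qed.

Section Hessian.
Context {n : nat} {f : 'cV[R]_n -> R}.
Hypothesis hf : twice_continuously_differentiable f.

Let df x : differentiable f x. Proof. by case: hf. Qed.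

Lemma grad_continuous : continuous (grad f).
Proof. by case: hf => _ dg _ x; apply: differentiable_continuous. Qed.

Lemma hess_continuous : continuous (hess f).
Proof. by case: hf. Qed.

Lemma C2_continuous : continuous f.
Proof. by move=> x; apply: differentiable_continuous. Qed.

Lemma grad_coord_differentiable i x : differentiable (fun y => grad f y i 0) x.
Proof.
case: hf => _ dg _.
apply: (@differentiable_comp _ _ _ _ (grad f) (fun M : 'cV[R]_n => M i 0)) => //.
exact: differentiable_coord.
Qed.

Lemma derive_grad_coord i x v :
  'D_v (fun y => grad f y i 0) x = (hess f x *m v) i 0.
Proof.
rewrite derive_grad; last exact: grad_coord_differentiable.
by rewrite dotE mxE; apply: eq_bigr => j _; rewrite !mxE.
Qed.

Lemma is_derive_f_line x v (t : R) :
  is_derive t 1 (fun u => f (x + u *: v)) (dot (grad f (x + t *: v)) v).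
Proof. by rewrite -derive_grad//; apply: is_derive_line; exact: diff_derivable. Qed.

Lemma is_derive_grad_coord_line i x v (t : R) :
  is_derive t 1 (fun u => grad f (x + u *: v) i 0) ((hess f (x + t *: v) *m v) i 0).
Proof.
rewrite -derive_grad_coord.
apply: (@is_derive_line _ (fun y => grad f y i 0)).
exact/diff_derivable/grad_coord_differentiable.
Qed.

Lemma is_derive_grad_line x v (t : R) :
  is_derive t 1 (fun u => dot (grad f (x + u *: v)) v)
    (dot v (hess f (x + t *: v) *m v)).
Proof.
have -> : (fun u => dot (grad f (x + u *: v)) v) =
    \sum_i (fun u => v i 0 *: grad f (x + u *: v) i 0).
  apply/funext => u; rewrite dotE fct_sumE; apply: eq_bigr => i _.
  by rewrite /GRing.scale /= mulrC.
rewrite dotE; apply: is_derive_sum => i.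
by apply: is_deriveZ; exact: is_derive_grad_coord_line.
Qed.

Lemma is_derive_within (g dg : R -> R) (A : set R) :
  (forall t : R, is_derive t 1 g (dg t)) -> {within A, continuous g}.
Proof.
move=> h; apply: continuous_subspaceT => t.
by apply: differentiable_continuous; apply/derivable1_diffP; case: (h t).
Qed.

(** Second-order Taylor bound along a segment on which the curvature is at most
    [K]: the mean value theorem bounds the first derivative, and a second use of
    it, on the difference of the two sides, bounds the function. *)
Lemma taylor_upper_bound x v K :
  (forall t, 0 <= t <= 1 -> dot v (hess f (x + t *: v) *m v) <= K) ->
  forall t, 0 <= t <= 1 ->
  f (x + t *: v) <= f x + t * dot (grad f x) v + t ^+ 2 / 2 * K.
Proof.
move=> hK t /andP[t0 t1].
have slope u : 0 <= u <= 1 ->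
    dot (grad f (x + u *: v)) v <= dot (grad f x) v + u * K.
  move=> /andP[u0 u1].
  have [|c + e] := @MVT_segment R _ _ 0 u u0 (fun r _ => is_derive_grad_line x v r).
    by apply: is_derive_within => r; exact: is_derive_grad_line.
  rewrite in_itv /= => /andP[c0 cu].
  move: e; rewrite subr0 scale0r addr0 => /eqP; rewrite subr_eq => /eqP ->.
  rewrite addrC lerD2l mulrC ler_wpM2l// hK// c0 /=.
  exact: le_trans cu u1.
pose g u := f (x + u *: v) - (u * dot (grad f x) v + u ^+ 2 / 2 * K).
have dg (u : R) : is_derive u 1 g (dot (grad f (x + u *: v)) v - (dot (grad f x) v + u * K)).
  apply: is_deriveB; first exact: is_derive_f_line.
  have -> : (fun u => u * dot (grad f x) v + u ^+ 2 / 2 * K) =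
     (fun u => dot (grad f x) v *: u) + (fun u => (K / 2) *: (u ^+ 2)).
    by apply/funext => r /=; rewrite /GRing.scale /= fctE; ring.
  have -> : dot (grad f x) v + u * K =
      dot (grad f x) v *: 1 + (K / 2) *: (2%:R *: u ^+ 1 *: 1).
    by rewrite /GRing.scale /=; field.
  apply: is_deriveD; apply: is_deriveZ.
  by apply: DeriveDef; [exact: exprn_derivable|exact: exp_derive].
have [|c + e] := @MVT_segment R _ _ 0 t t0 (fun r _ => dg r).
  exact: is_derive_within dg.
rewrite in_itv /= => /andP[c0 ct].
have : g t <= g 0.
  rewrite -subr_le0 e subr0 mulr_le0_ge0// subr_le0 slope// c0 /=.
  exact: le_trans ct t1.
rewrite /g scale0r addr0 mul0r expr0n /= !mul0r addr0 subr0 lerBlDr.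
by rewrite addrA.
Qed.

Lemma dot_delta (u : 'cV[R]_n) i : dot u (delta_mx i 0) = u i 0.
Proof.
rewrite dotE (bigD1 i)//= big1 ?addr0 => [|k ki]; rewrite !mxE ?eqxx ?mulr1//.
by rewrite (negbTE ki) mulr0.
Qed.

(** Two applications of the mean value theorem express the mixed second
    difference, which is symmetric in the two directions, by a value of the
    mixed derivative nearby. *)
Lemma second_difference_mvt x i j (h : R) : 0 < h ->
  exists2 y, `|x - y| <= h * (`|delta_mx i 0 : 'cV[R]_n| + `|delta_mx j 0 : 'cV[R]_n|) &
    f (x + h *: delta_mx j 0 + h *: delta_mx i 0) - f (x + h *: delta_mx i 0)
     - f (x + h *: delta_mx j 0) + f x = h ^+ 2 * hess f y i j.
Proof.
move=> h0; set ei := delta_mx i 0; set ej := delta_mx j 0.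
pose phi s := f (x + h *: ej + s *: ei) - f (x + s *: ei).
have dphi (s : R) : is_derive s 1 phi
    (grad f (x + h *: ej + s *: ei) i 0 - grad f (x + s *: ei) i 0).
  by rewrite -!dot_delta; apply: is_deriveB; exact: is_derive_f_line.
have [|xi + e] := @MVT_segment R _ _ 0 h (ltW h0) (fun r _ => dphi r).
  exact: is_derive_within dphi.
rewrite in_itv /= => /andP[xi0 xih].
have [|eta + e'] := @MVT_segment R _ _ 0 h (ltW h0)
    (fun r _ => is_derive_grad_coord_line i (x + xi *: ei) ej r).
  by apply: is_derive_within => r; exact: is_derive_grad_coord_line.
rewrite in_itv /= => /andP[eta0 etah].
exists (x + xi *: ei + eta *: ej).
  rewrite -addrA opprD addrA subrr add0r normrN mulrDr.
  apply: le_trans (ler_normD _ _) _; rewrite !normrZ !ger0_norm//.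
  by rewrite lerD// ler_wpM2r.
move: e e'; rewrite /phi !scale0r !addr0 subr0 [x + _ + xi *: _]addrAC => + e'.
rewrite e' -colE mxE => e.
by rewrite expr2 [_ * _ * hess _ _ _ _]mulrC mulrA -e; ring.
Qed.

(** Schwarz's theorem: the second difference divided by [h ^ 2] is a value of
    either mixed derivative near [x], and both are continuous at [x]. *)
Lemma hess_sym x : (hess f x)^T = hess f x.
Proof.
apply/matrixP => j i; rewrite mxE; apply/eqP; rewrite -subr_eq0 -normr_eq0.
rewrite eq_le normr_ge0 andbT; apply/ler_addgt0Pl => e e0; rewrite addr0.
have near_x k l : nbhs x [set y | `|hess f x k l - hess f y k l| < e / 2].
  have c : hess f y k l @[y --> x] --> hess f x k l.
    apply: (@continuous_comp _ _ _ (hess f) (fun M : 'M[R]_n => M k l)).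
      exact: hess_continuous.
    exact: coord_continuous.
  have e2 : 0 < e / 2 by rewrite divr_gt0.
  by move: c => /cvgrPdist_lt; apply.
pose N k l := [set y | `|hess f x k l - hess f y k l| < e / 2].
have /nbhs_ballP[r /= r0 rP] : nbhs x (N i j `&` N j i) 
  by apply: filterI; exact: near_x.
set c := `|delta_mx i 0 : 'cV[R]_n| + `|delta_mx j 0 : 'cV[R]_n|.
have c0 : 0 <= c by rewrite addr_ge0.
pose h := r / (c + 1).
have h0 : 0 < h by rewrite divr_gt0// ltr_wpDl.
have hc : h * c < r.
  by rewrite /h -mulrA gtr_pMr// mulrC ltr_pdivrMr ?mul1r ?ltrDl// ltr_wpDl.
have [y yx Ey] := second_difference_mvt x i j h0.
have [z zx Ez] := second_difference_mvt x j i h0.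
have Eyz : hess f y i j = hess f z j i.
  have h20 : h ^+ 2 != 0 by rewrite expf_neq0// gt_eqF.
  apply: (mulfI h20); rewrite -Ey -Ez.
  by rewrite [x + _ + h *: delta_mx i 0]addrAC; ring.
have [/= /ltW Hy _] : (N i j `&` N j i) y.
  by apply: rP; rewrite -ball_normE /=; exact: le_lt_trans yx hc.
have [/= _ /ltW Hz] : (N i j `&` N j i) z.
  by apply: rP; rewrite -ball_normE /=; apply: le_lt_trans zx _; rewrite addrC.
have Hz' : `|hess f y i j - hess f x j i| <= e / 2 by rewrite Eyz distrC.
rewrite [e]splitr; apply: le_trans (lerD Hy Hz').
exact: ler_distD.
Qed.

End Hessian.

End Calculus.

(** * Measurability of matrix-valued maps *)

Section MeasurableMatrices.
Context {R : realType} {d : measure_display} {T : measurableType d}.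

Definition measurable_mx m n (F : T -> 'M[R]_(m, n)) : Prop :=
  forall i j, measurable_fun setT (fun w => F w i j).

Lemma measurable_forall (I : countType) (P : I -> T -> Prop) :
  (forall i, measurable [set w | P i w]) -> measurable [set w | forall i, P i w].
Proof.
move=> mP; have -> : [set w | forall i, P i w] = ~` (\bigcup_i ~` [set w | P i w]).
  apply/seteqP; split=> [w h [i _] /= nP|w /= h i]; first exact: nP (h i).
  by apply: contrapT => nP; apply: h; exists i.
apply/measurableC/countable_bigcupT_measurable => //.
by move=> i; exact/measurableC.
Qed.

Lemma measurable_ler (g h : T -> R) : measurable_fun setT g ->
  measurable_fun setT h -> measurable [set w | g w <= h w].
Proof.
move=> mg mh; rewrite -[X in measurable X]setTI.
exact: (measurable_fun_ler mg mh measurableT (Y := [set true])).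
Qed.

Lemma measurable_ltr (g h : T -> R) : measurable_fun setT g ->
  measurable_fun setT h -> measurable [set w | g w < h w].
Proof.
move=> mg mh; rewrite -[X in measurable X]setTI.
exact: (measurable_fun_ltr mg mh measurableT (Y := [set true])).
Qed.

Lemma measurable_fun_of_gt (h : T -> R) :
  (forall c, measurable [set w | c < h w]) -> measurable_fun setT h.
Proof.
move=> mh; apply: (measurability _ (RGenOInfty.measurableE R)).
by move=> _ [_ [a ->] <-]; rewrite setTI preimage_itvoy.
Qed.

Lemma measurable_fun_of_ge (h : T -> R) :
  (forall c, measurable [set w | c <= h w]) -> measurable_fun setT h.
Proof.
move=> mh; apply: (measurability _ (RGenCInfty.measurableE R)).
by move=> _ [_ [a ->] <-]; rewrite setTI preimage_itvcy.
Qed.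

(** An open set is the union of the boxes with rational centre and radius that
    it contains, and the preimage of a box is measurable. *)
Lemma measurable_continuous_comp m n (g : 'M[R]_(m, n) -> R) F :
  continuous g -> measurable_mx F -> measurable_fun setT (fun w => g (F w)).
Proof.
move=> cg mF; apply: measurable_fun_of_gt => c.
pose box (k : 'M[rat]_(m, n) * rat) :=
  [set N : 'M[R]_(m, n) | forall ij : 'I_m * 'I_n,
     `|N ij.1 ij.2 - ratr (k.1 ij.1 ij.2)| < ratr k.2].
pose inside k := box k `<=` [set N | c < g N].
have -> : [set w | c < g (F w)] =
    \bigcup_k (if `[< inside k >] then F @^-1` box k else set0).
  apply/seteqP; split=> [w /= cw|w [k _]]; last by case: asboolP => // + Fw; apply.
  have nU : nbhs (F w) [set N | c < g N].
    by apply: (cg (F w) [set r | c < r]); exact: lt_nbhsr.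
  have /nbhs_ballP[r /= r0 rU] := nU.
  have [e] := rat_in_itvoo (divr_gt0 r0 (ltr0n R 2)).
  rewrite in_itv /= => /andP[e0 er].
  have [q] : exists q : 'M[rat]_(m, n), ball (F w) (ratr e) (map_mx ratr q).
    by apply: nbhs_rat_mx; exact: nbhsx_ballx.
  case=> _ qF; exists (q, e) => //; case: asboolP => [_ [i j] /=|].
    by have := qF i j; rewrite mxE.
  move=> nI; exfalso; apply: nI => N Nq; apply: rU; split => // i j; rewrite /ball /=.
  rewrite [r]splitr; apply: le_lt_trans (ler_distD (ratr (q i j)) _ _) _.
  apply: ltrD; apply: lt_trans er; first by have := qF i j; rewrite mxE.
  by rewrite distrC; exact: (Nq (i, j)).
apply: countable_bigcupT_measurable => // k; case: ifP => // _.
apply: measurable_forall => -[i j] /=; apply: measurable_ltr.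
  by apply: measurableT_comp => //; apply: measurable_funB.
exact: measurable_cst.
Qed.

Lemma measurable_mx_continuous_comp m n p q (g : 'M[R]_(m, n) -> 'M[R]_(p, q)) F :
  continuous g -> measurable_mx F -> measurable_mx (fun w => g (F w)).
Proof.
move=> cg mF i j; apply: (measurable_continuous_comp (g := fun M => g M i j)) => //.
move=> M; apply: (@continuous_comp _ _ _ g (fun N : 'M[R]_(p, q) => N i j)).
  exact: cg.
exact: coord_continuous.
Qed.

Lemma measurable_mx_cst m n (M : 'M[R]_(m, n)) : measurable_mx (fun=> M).
Proof. by move=> i j; exact: measurable_cst. Qed.

Lemma measurable_mx_tr m n (F : T -> 'M[R]_(m, n)) :
  measurable_mx F -> measurable_mx (fun w => (F w)^T).
Proof. by move=> mF i j; under eq_fun do rewrite mxE; exact: mF. Qed.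

Lemma measurable_mx_add m n (F G : T -> 'M[R]_(m, n)) :
  measurable_mx F -> measurable_mx G -> measurable_mx (fun w => F w + G w).
Proof.
by move=> mF mG i j; under eq_fun do rewrite mxE; apply: measurable_funD.
Qed.

Lemma measurable_mx_opp m n (F : T -> 'M[R]_(m, n)) :
  measurable_mx F -> measurable_mx (fun w => - F w).
Proof.
by move=> mF i j; under eq_fun do rewrite mxE; apply: measurable_funN.
Qed.

Lemma measurable_mx_scale m n (a : T -> R) (F : T -> 'M[R]_(m, n)) :
  measurable_fun setT a -> measurable_mx F -> measurable_mx (fun w => a w *: F w).
Proof.
by move=> ma mF i j; under eq_fun do rewrite mxE; apply: measurable_funM.
Qed.

Lemma measurable_mx_mul m n p (F : T -> 'M[R]_(m, n)) (G : T -> 'M[R]_(n, p)) :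
  measurable_mx F -> measurable_mx G -> measurable_mx (fun w => F w *m G w).
Proof.
move=> mF mG i j; under eq_fun do rewrite mxE.
by apply: measurable_sum => k; apply: measurable_funM.
Qed.

Lemma measurable_mx_scalar n (a : T -> R) :
  measurable_fun setT a -> measurable_mx (fun w => (a w)%:M : 'M[R]_n).
Proof.
move=> ma i j; under eq_fun do rewrite mxE.
by case: eqVneq => _ /=; [under eq_fun do rewrite mulr1n|
  under eq_fun do rewrite mulr0n; exact: measurable_cst].
Qed.

Lemma measurable_dot n (F G : T -> 'cV[R]_n) :
  measurable_mx F -> measurable_mx G ->
  measurable_fun setT (fun w => dot (F w) (G w)).
Proof.
by move=> mF mG; apply: measurable_mx_mul => //; exact: measurable_mx_tr.
Qed.

Lemma norm2_continuous n : continuous (@norm2 R n).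
Proof.
have -> : @norm2 R n = (fun v => Num.sqrt (dot v v)).
  by apply/funext => v; rewrite norm2E.
move=> v; apply: (@continuous_comp _ _ _ (fun v : 'cV[R]_n => dot v v) Num.sqrt).
  by apply: dot_continuous => u; exact: cvg_id.
exact: sqrt_continuous.
Qed.

Lemma measurable_norm2 n (F : T -> 'cV[R]_n) :
  measurable_mx F -> measurable_fun setT (fun w => norm2 (F w)).
Proof. exact/measurable_continuous_comp/norm2_continuous. Qed.

(** That [c] is at most the least eigenvalue is a family of inequalities between
    quadratic forms, which may be restricted to rational vectors. *)
Lemma measurable_lambda_min n (F : T -> 'M[R]_n) : (0 < n)%N ->
  (forall w, (F w)^T = F w) -> measurable_mx F ->
  measurable_fun setT (fun w => lambda_min (F w)).
Proof.
move=> n0 FT mF; apply: measurable_fun_of_ge => c.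
have -> : [set w | c <= lambda_min (F w)] = [set w | forall q : 'cV[rat]_n,
    c * dot (map_mx ratr q) (map_mx ratr q) <=
    dot (map_mx ratr q) (F w *m map_mx ratr q)].
  apply/seteqP; split=> w /=; first by move=> /(lambda_min_geP _ n0 (FT w)) h q.
  move=> h; apply/(lambda_min_geP _ n0 (FT w)); apply: le_continuous_rat => //.
    move=> v; apply: (@cvgM _ _ (nbhs v)); first exact: cvg_cst.
    by apply: dot_continuous => u; exact: cvg_id.
  by apply: dot_continuous; [move=> u; exact: cvg_id|exact: mulmx_continuous].
apply: measurable_forall => q; apply: measurable_ler; first exact: measurable_cst.
by apply: measurable_dot; [|apply: measurable_mx_mul => //]; exact: measurable_mx_cst.
Qed.

Lemma measurable_spectral_norm_le m n (F : T -> 'M[R]_(m, n)) c : 0 <= c ->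
  measurable_mx F -> measurable [set w | spectral_norm (F w) <= c].
Proof.
move=> c0 mF.
have -> : [set w | spectral_norm (F w) <= c] = [set w | forall q : 'cV[rat]_n,
    norm2 (F w *m map_mx ratr q) <= c * norm2 (map_mx ratr q)].
  apply/seteqP; split=> w /=; first by move=> /(spectral_norm_leP _ c0) h q.
  move=> h; apply/(spectral_norm_leP _ c0); apply: le_continuous_rat => //.
    move=> v; apply: (@continuous_comp _ _ _ (mulmx (F w)) (@norm2 R m)).
      exact: mulmx_continuous.
    exact: norm2_continuous.
  by move=> v; apply: (@cvgM _ _ (nbhs v)); [exact: cvg_cst|exact: norm2_continuous].
apply: measurable_forall => q; apply: measurable_ler; last exact: measurable_cst.
by apply: measurable_norm2; apply: measurable_mx_mul => //; exact: measurable_mx_cst.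
Qed.

(** The identity [y^-1 = y * (y^2)^-1], also valid at 0, reduces inversion to a
    real power of a nonnegative number. *)
Lemma measurable_inv (g : T -> R) :
  measurable_fun setT g -> measurable_fun setT (fun w => (g w)^-1).
Proof.
move=> mg; have -> : (fun w => (g w)^-1) = (fun w => g w * (g w ^+ 2) `^ (-1)).
  apply/funext => w; rewrite powR_inv1 ?sqr_ge0//.
  have [->|g0] := eqVneq (g w) 0; first by rewrite invr0 mul0r.
  by field.
apply: measurable_funM => //.
exact: (@measurable_comp _ _ _ _ _ _ setT (fun x : R => x `^ (-1)) setT
  (fun w => g w ^+ 2) measurableT (fun _ _ => I) (@measurable_powR R (-1))
  (measurable_funX 2 mg)).
Qed.

Lemma measurable_det n (F : T -> 'M[R]_n) :
  measurable_mx F -> measurable_fun setT (fun w => \det (F w)).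
Proof.
move=> mF; apply: measurable_sum => s.
by apply: measurable_funM => //; apply: measurable_prod => i _; exact: mF.
Qed.

(** Cramer's rule on the measurable set where the determinant does not vanish;
    elsewhere [invmx] is the identity map. *)
Lemma measurable_invmx n (F : T -> 'M[R]_n) :
  measurable_mx F -> measurable_mx (fun w => invmx (F w)).
Proof.
move=> mF i j.
have -> : (fun w => invmx (F w) i j) = (fun w => if \det (F w) == 0 then F w i j
    else (\det (F w))^-1 * ((-1) ^+ (j + i) * \det (row' j (col' i (F w))))).
  apply/funext => w; rewrite /invmx unitmxE unitfE.
  by case: eqP => //= _; rewrite !mxE.
apply: measurable_fun_ifT.
- apply: measurable_fun_eqr; [exact: measurable_det|exact: measurable_cst].
- exact: mF.
- apply: measurable_funM; first exact/measurable_inv/measurable_det.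
  apply: measurable_funM => //; apply: measurable_det => k l.
  by under eq_fun do rewrite !mxE; exact: mF.
Qed.

Lemma measurable_nat_select (N : T -> nat) (G : nat -> T -> R) :
  (forall l, measurable [set w | N w = l]) ->
  (forall l, measurable_fun setT (G l)) ->
  measurable_fun setT (fun w => G (N w) w).
Proof.
move=> mN mG; apply: measurable_fun_of_gt => c.
have -> : [set w | c < G (N w) w] =
    \bigcup_l ([set w | N w = l] `&` [set w | c < G l w]).
  by apply/seteqP; split=> [w /= h|w [l _ [/= <- //]]]; exists (N w).
apply: bigcup_measurable => l _; apply: measurableI => //.
by apply: measurable_ltr => //; exact: measurable_cst.
Qed.

End MeasurableMatrices.

(** * Independence of blocks of variables *)

Section Independence.
Context {R : realType} {d : measure_display} {T : measurableType d}.
Variable Pr : probability T R.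

(** Probabilities are finite, and real-valued ones can be handled by [lra]. *)
Definition prob (A : set T) : R := fine (Pr A).

Lemma probE A : measurable A -> Pr A = (prob A)%:E.
Proof. by move=> mA; rewrite /prob fineK// fin_num_measure. Qed.

Lemma prob_ge0 A : 0 <= prob A.
Proof. by rewrite /prob fine_ge0. Qed.

Lemma prob_le A B : measurable A -> measurable B -> A `<=` B -> prob A <= prob B.
Proof.
move=> mA mB AB; rewrite -lee_fin -!probE//.
by apply: le_measure; rewrite ?inE.
Qed.

Lemma probT : prob setT = 1.
Proof. by rewrite /prob probability_setT. Qed.

Lemma probC A : measurable A -> prob (~` A) = 1 - prob A.
Proof.
move=> mA; apply: EFin_inj; rewrite EFinB -!probE//; last exact: measurableC.
by rewrite probability_setC.
Qed.

Lemma prob_split A B : measurable A -> measurable B ->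
  prob A = prob (A `&` B) + prob (A `&` ~` B).
Proof.
move=> mA mB; apply: EFin_inj; rewrite EFinD -!probE//; last 2 first.
- by apply: measurableI => //; exact: measurableC.
- exact: measurableI.
by rewrite -setDE (measureDI Pr mA mB) addeC.
Qed.

Lemma probU_le A B : measurable A -> measurable B ->
  prob (A `|` B) <= prob A + prob B.
Proof.
move=> mA mB; rewrite -lee_fin EFinD -!probE//; last exact: measurableU.
exact: measureU2.
Qed.

(** The events independent of a given one are closed under complement and
    countable disjoint union. *)
Lemma independent_of_lambda_system E : measurable E ->
  lambda_system setT [set A | measurable A /\ (Pr (A `&` E) = Pr A * Pr E)%E].
Proof.
move=> mE; apply/dynkin_lambda_system; split=> /=.
- by split=> //; rewrite setTI probability_setT mul1e.
- move=> A [mA AE]; have mC := measurableC mA; split=> //.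
  have mI B : measurable B -> measurable (B `&` E) by move=> mB; exact: measurableI.
  have {}AE : prob (A `&` E) = prob A * prob E.
    by apply: EFin_inj; rewrite EFinM -!probE//; exact: mI.
  rewrite (probE (mI _ mC)) (probE mC) (probE mE) -EFinM; congr EFin.
  have := prob_split mE mA; rewrite (setIC E) (setIC E) AE probC// => h.
  by lra.
- move=> F tF hF; have mF k : measurable (F k) by case: (hF k).
  have mU : measurable (\bigcup_k F k) by exact: bigcupT_measurable.
  split=> //; rewrite setI_bigcupl measure_bigcup//; first last.
  - by apply: trivIset_setIr.
  - by move=> k _; exact: measurableI.
  rewrite measure_bigcup// [in RHS]probE// [RHS]muleC -nneseriesZl//.
  apply: eq_eseriesr => k _; case: (hF k) => _ FE.
  by transitivity (Pr (F k) * Pr E)%E; [exact: FE|rewrite (probE mE) muleC].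
Qed.

(** The pi-lambda theorem, applied to one factor at a time. *)
Lemma independent_generated (G1 G2 : set (set T)) :
  setI_closed G1 -> setI_closed G2 ->
  G1 `<=` measurable -> G2 `<=` measurable ->
  (forall A B, G1 A -> G2 B -> (Pr (A `&` B) = Pr A * Pr B)%E) ->
  forall A B, <<s G1 >> A -> <<s G2 >> B -> (Pr (A `&` B) = Pr A * Pr B)%E.
Proof.
move=> I1 I2 m1 m2 h A B sA sB.
have [] : [set A | measurable A /\ (Pr (A `&` B) = Pr A * Pr B)%E] A; last by [].
have mB : measurable B.
  have : <<s G2 >> `<=` (measurable : set (set T)).
    by apply: smallest_sub => //; exact: sigma_algebra_measurable.
  exact.
move: A sA; apply: (lambda_system_subset I1 (independent_of_lambda_system mB)) => //.
move=> A GA; split; first exact: m1.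
have [] : [set B | measurable B /\ (Pr (B `&` A) = Pr B * Pr A)%E] B; last first.
  by move=> _; rewrite setIC muleC.
move: B sB {mB}.
apply: (lambda_system_subset I2 (independent_of_lambda_system (m1 _ GA))) => //.
by move=> B GB; split; [exact: m2|rewrite setIC h// muleC].
Qed.

Context {I : eqType} (X : I -> {RV Pr >-> R}).

(** This pi-system generates the sigma-algebra of the variables with index in
    [J]. Every index of [J] carries a constraint, trivial ones being allowed, so
    that the intersection of two cylinders is taken index by index. *)
Definition cylinders (J : seq I) : set (set T) :=
  [set A | exists2 B : I -> set R, (forall i, measurable (B i)) &
    A = \big[setI/setT]_(i <- J) (X i @^-1` B i)].

Lemma cylinders_setI J : setI_closed (cylinders J).
Proof.
move=> _ _ [B mB ->] [C mC ->]; exists (fun i => B i `&` C i).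
  by move=> i; exact: measurableI.
by rewrite -big_split.
Qed.

Lemma cylinders_measurable J : cylinders J `<=` measurable.
Proof.
move=> _ [B mB ->]; apply: bigsetI_measurable => i _.
exact: measurable_funPTI.
Qed.

Lemma generated_measurable J A : <<s cylinders J >> A -> measurable A.
Proof.
have : <<s cylinders J >> `<=` (measurable : set (set T)).
  apply: smallest_sub; last exact: cylinders_measurable.
  exact: sigma_algebra_measurable.
exact.
Qed.

Lemma bigsetIP (J : seq I) (P : I -> set T) w :
  (\big[setI/setT]_(i <- J) P i) w <-> forall i, i \in J -> P i w.
Proof.
elim: J => [|j J ih]; first by rewrite big_nil; split.
rewrite big_cons; split=> [[Pj /ih h] i|h].
  by rewrite inE => /predU1P[->//|/h].
split; first by apply: h; rewrite mem_head.
by apply/ih => i iJ; apply: h; rewrite inE iJ orbT.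
Qed.

Lemma measurable_generated (J : seq I) i : i \in J ->
  measurable_fun setT (X i : g_sigma_algebraType (cylinders J) -> R).
Proof.
move=> iJ _ B mB; rewrite setTI; apply: sub_sigma_algebra.
exists (fun j => if j == i then B else setT); first by move=> j; case: ifP.
apply/seteqP; split=> [w Bw|w /bigsetIP/(_ i iJ)]; last by rewrite eqxx.
by apply/bigsetIP => j _ /=; case: eqVneq => [->|].
Qed.

Lemma generated_mono J K : {subset J <= K} -> <<s cylinders J >> `<=` <<s cylinders K >>.
Proof.
move=> JK; apply: smallest_sub; first exact: smallest_sigma_algebra.
move=> _ [B mB ->].
have h : forall j, j \in J -> (<<s cylinders K >> : set (set T)) (X j @^-1` B j).
  move=> j /JK jK; have := @measurable_generated K j jK measurableT (B j) (mB j).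
  by rewrite setTI.
rewrite big_seq_cond.
elim/big_ind : _ => [| A C| j].
- exact: (@measurableT _ (g_sigma_algebraType (cylinders K))).
- exact: (@measurableI _ (g_sigma_algebraType (cylinders K))).
- by rewrite andbT => /h.
Qed.

(** Two cylinders over disjoint blocks intersect in a cylinder over their union,
    to which the product rule applies. *)
Lemma independent_blocks J K : mutually_independent X -> uniq (J ++ K) ->
  forall A B, <<s cylinders J >> A -> <<s cylinders K >> B ->
  (Pr (A `&` B) = Pr A * Pr B)%E.
Proof.
move=> iX uJK; have := uJK; rewrite cat_uniq => /and3P[uJ JK uK].
apply: independent_generated; try exact: cylinders_setI;
  try exact: cylinders_measurable.
move=> _ _ [B mB ->] [C mC ->].
pose D i := if i \in J then B i else C i.
have DJ i : i \in J -> D i = B i by rewrite /D => ->.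
have DK i : i \in K -> D i = C i.
  by move=> iK; rewrite /D ifN//; apply: contra JK => iJ; apply/hasP; exists i.
have -> : \big[setI/setT]_(i <- J) (X i @^-1` B i) =
    \big[setI/setT]_(i <- J) (X i @^-1` D i).
  by apply: eq_big_seq => i iJ; rewrite DJ.
have -> : \big[setI/setT]_(i <- K) (X i @^-1` C i) =
    \big[setI/setT]_(i <- K) (X i @^-1` D i).
  by apply: eq_big_seq => i iK; rewrite DK.
have mD i : measurable (D i) by rewrite /D; case: ifP.
by rewrite -big_cat !iX// big_cat.
Qed.

End Independence.

(** * Success probability given the past *)

Section ConditionalSuccess.
Context {R : realType} {d : measure_display} {T : measurableType d}.
Variable Pr : probability T R.

Lemma prob_bigcup (F : nat -> set T) : (forall k, measurable (F k)) ->
  trivIset setT F -> Pr (\bigcup_k F k) = (\sum_(k <oo) Pr (F k))%E.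
Proof.
by move=> mF tF; apply: measure_semi_bigcup => //; exact: bigcupT_measurable.
Qed.

(** Total probability over a countable partition: on each cell, independence
    reduces the success probability to that of the one event used there. *)
Lemma success_countable (A : set T) (cell good : nat -> set T) (q : R) :
  0 <= q -> measurable A ->
  (forall k, measurable (cell k)) -> (forall k, measurable (good k)) ->
  trivIset setT cell -> \bigcup_k cell k = setT ->
  (forall k, (Pr ((A `&` cell k) `&` good k) = Pr (A `&` cell k) * Pr (good k))%E) ->
  (forall k, cell k !=set0 -> (q%:E <= Pr (good k))%E) ->
  (q%:E * Pr A <= Pr (A `&` \bigcup_k (cell k `&` good k)))%E.
Proof.
move=> q0 mA mC mG tC covC ind hq.
have mAC k : measurable (A `&` cell k) by exact: measurableI.
rewrite -[A in leLHS]setIT -covC !setI_bigcupr !prob_bigcup//; first last.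
- by apply: trivIset_setIl.
- apply: trivIset_setIl => i j _ _ [w [[ci _] [cj _]]].
  by apply: (tC i j) => //; exists w.
- by move=> k; apply: measurableI => //; exact: measurableI.
rewrite -nneseriesZl//; apply: lee_nneseries => [k _ _|k _].
  by rewrite mule_ge0// lee_fin.
rewrite setIA ind muleC.
have [[w [Aw cw]]|/set0P/negP/negPn/eqP ->] := pselect (A `&` cell k !=set0).
  by apply: lee_wpmul2l => //; apply: hq; exists w.
by rewrite measure0 !mul0e.
Qed.

Context {I : eqType} (X : I -> {RV Pr >-> R}).

Lemma measurable_mx_generated (J : seq I) m n (F : T -> 'M[R]_(m, n)) :
  measurable_mx (F : g_sigma_algebraType (cylinders X J) -> 'M[R]_(m, n)) ->
  measurable_mx F.
Proof.
move=> mF i j _ B mB; rewrite setTI; apply: (@generated_measurable _ _ _ _ _ X J).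
by have := mF i j measurableT B mB; rewrite setTI.
Qed.

Let grid n (j : nat) (v : 'cV[R]_n) : 'cV[int]_n := \col_i Num.floor (v i 0 * j.+1%:R).
Let node n (j : nat) (z : 'cV[int]_n) : 'cV[R]_n := \col_i ((z i 0)%:~R / j.+1%:R).

Let node_grid_cvg n (v : 'cV[R]_n) : node j (grid j v) @[j --> \oo] --> v.
Proof.
apply: cvg_mx => i k; rewrite ord1 {k}; apply/cvgrPdist_le => e e0.
near=> j; rewrite !mxE.
have j0 : 0 < j.+1%:R :> R by rewrite ltr0n.
set x := v i 0 * _; have /andP[xl xu] := floor_itv x.
have -> : v i 0 - (Num.floor x)%:~R / j.+1%:R = (x - (Num.floor x)%:~R) / j.+1%:R.
  by rewrite mulrBl /x mulfK// gt_eqF.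
rewrite ger0_norm; last by rewrite divr_ge0// subr_ge0.
rewrite ler_pdivrMr//.
apply: (@le_trans _ _ 1); first by rewrite lerBlDr ltW// addrC -intrD1.
rewrite -ler_pdivrMl// mulr1; near: j.
have : \forall k \near \oo, e^-1 <= k%:R :> R by exact: nbhs_infty_ger.
by apply: filterS => k /le_trans; apply; rewrite ler_nat.
Unshelve. all: by end_near. Qed.

(** Freezing lemma, without conditional expectations: the vector [G] is known to
    the past, the matrix [Z] is independent of it, and each fixed vector [v] is
    good for [Z] with probability at least [q]. Rounding [G] to a grid leaves
    countably many values, for which independence is enough; the goodness
    predicate is closed in the vector, so it survives the passage to the limit
    superior of the rounded events. *)
Lemma freezing (J K : seq I) s n p (Q : 'M[R]_(s, p) -> 'cV[R]_n -> Prop)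
    (Z : T -> 'M[R]_(s, p)) (G : T -> 'cV[R]_n) (A : set T) (q : R) :
  mutually_independent X -> uniq (J ++ K) -> 0 <= q ->
  measurable_mx (G : g_sigma_algebraType (cylinders X J) -> 'cV[R]_n) ->
  (forall v, (<<s cylinders X K >> : set (set T)) [set w | Q (Z w) v]) ->
  (forall v, (q%:E <= Pr [set w | Q (Z w) v])%E) ->
  (forall M, closed [set v | Q M v]) ->
  measurable [set w | Q (Z w) (G w)] ->
  <<s cylinders X J >> A ->
  (q%:E * Pr A <= Pr (A `&` [set w | Q (Z w) (G w)]))%E.
Proof.
move=> iX uJK q0 mG mQ hq cQ mQG sA.
have mA := generated_measurable sA.
have mQ' v := generated_measurable (mQ v).
pose zk k : 'cV[int]_n := odflt 0 (pickle_inv k).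
pose cell j k := if pickle_inv k is Some z then [set w | grid j (G w) = z] else set0.
have sC j k : (<<s cylinders X J >> : set (set T)) (cell j k).
  rewrite /cell; case: pickle_inv => [z|]; last first.
    exact: (@measurable0 _ (g_sigma_algebraType (cylinders X J))).
  have -> : [set w | grid j (G w) = z] =
      [set w | forall i, ((z i 0)%:~R <= G w i 0 * j.+1%:R) /\
                         (G w i 0 * j.+1%:R < (z i 0 + 1)%:~R)].
    apply/seteqP; split=> [w /= <- i|w /= h].
      by rewrite !mxE; apply/andP; exact: floor_itv.
    apply/matrixP => i k'; rewrite ord1 mxE; have [h1 h2] := h i.
    by apply: floor_def; rewrite h1.
  apply: (@measurable_forall _ (g_sigma_algebraType (cylinders X J))) => i.
  apply: (@measurableI _ (g_sigma_algebraType (cylinders X J))).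
    apply: (@measurable_ler R _ (g_sigma_algebraType (cylinders X J))).
      exact: measurable_cst.
    by apply: measurable_funM; [exact: mG|exact: measurable_cst].
  apply: (@measurable_ltr R _ (g_sigma_algebraType (cylinders X J))).
    by apply: measurable_funM; [exact: mG|exact: measurable_cst].
  exact: measurable_cst.
have mC j k := generated_measurable (sC j k).
pose good j k := [set w | Q (Z w) (node j (zk k))].
pose F j := A `&` \bigcup_k (cell j k `&` good j k).
have FE j : F j = A `&` [set w | Q (Z w) (node j (grid j (G w)))].
  apply/seteqP; split=> w [Aw].
    case=> k _ ck; split=> //; move: ck; rewrite /cell /good /zk /=.
    by case: pickle_inv => [z [/= ->]|[]].
  move=> Qw; split=> //; exists (pickle (grid j (G w))) => //.
  by rewrite /cell /good /zk /= pickleK_inv.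
have hF j : (q%:E * Pr A <= Pr (F j))%E.
  apply: success_countable => //.
  - by move=> k; exact: mQ'.
  - move=> k l _ _ [w []]; rewrite /cell.
    have := @pickle_invK 'cV[int]_n k; have := @pickle_invK 'cV[int]_n l.
    by move: (pickle_inv k) (pickle_inv l) => [z|] [z'|] //= <- <- -> ->.
  - apply/seteqP; split=> // w _; exists (pickle (grid j (G w))) => //.
    by rewrite /cell pickleK_inv.
  - move=> k; apply: (independent_blocks iX uJK); last exact: mQ.
    apply: (@measurableI _ (g_sigma_algebraType (cylinders X J))).
      exact: sA.
    exact: sC.
  - by move=> k _; exact: hq.
have mF j : measurable (F j).
  apply: measurableI => //; apply: bigcupT_measurable => k.
  by apply: measurableI; [exact: mC|exact: mQ'].
have cF : Pr (\bigcup_(k >= n) F k) @[n --> \oo] --> Pr (lim_sup_set F).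
  apply: lim_sup_set_cvg => //; apply: le_lt_trans (ltry 1).
  by apply: probability_le1; exact: bigcup_measurable.
have mU N : measurable (\bigcup_(k >= N) F k) by exact: bigcup_measurable.
apply: (@le_trans _ _ (Pr (lim_sup_set F))).
  apply: (cvge_to_ge cF); near=> j; apply: le_trans (hF j) _.
  by apply: le_measure; rewrite ?inE//; apply: bigcup_sup => /=.
apply: le_measure; rewrite ?inE//.
- by apply: bigcap_measurable => // k _; exact: bigcup_measurable.
- exact: measurableI.
move=> w h; split; first by have [j _ []] := h 0%N Logic.I.
apply: contrapT => nQ.
have /(@node_grid_cvg _ (G w)) [N _ hN] : nbhs (G w) (~` [set v | Q (Z w) v]).
  by apply: open_nbhs_nbhs; split => //; exact: closed_openC.
have [j /= Nj] := h N Logic.I.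
by rewrite FE => -[_ /=]; exact: (hN j Nj).
Unshelve. all: by end_near. Qed.

End ConditionalSuccess.

(** * A Chernoff bound for dependent trials *)

Section Chernoff.
Context {R : realType} {d : measure_display} {T : measurableType d}.
Variable Pr : probability T R.

Definition hits (E : nat -> set T) (k : nat) (w : T) : nat :=
  \sum_(i < k) `[< E i w >].

Lemma hitsS E k w : hits E k.+1 w = (hits E k w + `[< E k w >])%N.
Proof. by rewrite /hits big_ord_recr. Qed.

Lemma hits_le E k w : (hits E k w <= k)%N.
Proof.
elim: k => [|k ih]; first by rewrite /hits big_ord0.
by rewrite hitsS -addn1 leq_add// leq_b1.
Qed.

Lemma hits_eqS E k j : [set w | hits E k.+1 w = j] =
  ([set w | hits E k w = j] `&` ~` E k) `|`
  (if j is j'.+1 then [set w | hits E k w = j'] `&` E k else set0).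
Proof.
apply/seteqP; split=> w /=; rewrite hitsS; case: asboolP => Ew.
- by rewrite addn1 => <-; right.
- by rewrite addn0; left.
- by case=> [[//]|]; case: j => [//|j [/= -> _]]; rewrite addn1.
- by rewrite addn0; case=> [[]//|]; case: j => [//|j []].
Qed.

Lemma measurable_hits (E : nat -> set T) k j :
  (forall i, (i < k)%N -> measurable (E i)) -> measurable [set w | hits E k w = j].
Proof.
elim: k j => [|k ih] j mE.
  rewrite (_ : [set _ | _] = if 0%N == j then setT else set0); first by case: ifP.
  by apply/seteqP; split=> w /=; rewrite /hits big_ord0; case: eqP.
have mEk : measurable (E k) by exact: mE.
have mH i : measurable [set w | hits E k w = i].
  by apply: ih => l lk; apply: mE; exact: ltnW.
rewrite hits_eqS; apply: measurableU.
  by apply: measurableI => //; exact: measurableC.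
by case: j => // j; exact: measurableI.
Qed.

(** The derivative of the difference of the two sides has the sign given by
    [1 - x <= exp (- x)]. *)
Lemma expRN_le (x : R) : 0 <= x -> expR (- x) <= 1 - x + x ^+ 2 / 2.
Proof.
move=> x0; pose g (t : R) := expR (- t) - (1 - t + t ^+ 2 / 2).
have dg (t : R) : is_derive t 1 g (- expR (- t) - (- 1 + t)).
  apply: is_deriveB.
    have -> : - expR (- t) = expR (- t) *: (- 1) by rewrite /GRing.scale /= mulrN1.
    by apply: is_derive1_comp.
  have dlin : is_derive t 1 (cst 1 - (id : R -> R)) (0 - 1).
    exact: is_deriveB.
  have dsq : is_derive t 1 (fun r : R => 2^-1 *: (r ^+ 2)) (2^-1 *: (2%:R *: t ^+ 1 *: 1)).
    apply: is_deriveZ; apply: DeriveDef; first exact: exprn_derivable.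
    exact: exp_derive.
  have -> : (fun t : R => 1 - t + t ^+ 2 / 2) =
      (cst 1 - (id : R -> R)) + (fun r : R => 2^-1 *: (r ^+ 2)).
    by apply/funext => r /=; rewrite /GRing.scale /= fctE mulrC.
  have -> : - 1 + t = (0 - 1) + 2^-1 *: (2%:R *: t ^+ 1 *: 1).
    by rewrite /GRing.scale /=; field.
  exact: is_deriveD dlin dsq.
have [|c + e] := @MVT_segment R _ _ 0 x x0 (fun r _ => dg r).
  exact: is_derive_within dg.
rewrite in_itv /= => /andP[c0 cx].
have : g x <= g 0.
  rewrite -subr_le0 e subr0 mulr_le0_ge0//.
  by have := expR_ge1Dx (- c); lra.
by rewrite /g oppr0 expR0 expr0n /= => h; lra.
Qed.

Section Bound.
Variables (E : nat -> set T) (q : R).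
Hypotheses (mE : forall k, measurable (E k)) (q01 : 0 <= q <= 1).
Hypothesis hE : forall k j, q * prob Pr [set w | hits E k w = j] <=
  prob Pr ([set w | hits E k w = j] `&` E k).

Let measurable_hitsE k j : measurable [set w | hits E k w = j].
Proof. exact: measurable_hits. Qed.

Lemma prob_hits_eqS k j : prob Pr [set w | hits E k.+1 w = j] <=
  prob Pr ([set w | hits E k w = j] `&` ~` E k) +
  (if j is j'.+1 then prob Pr ([set w | hits E k w = j'] `&` E k) else 0).
Proof.
rewrite hits_eqS; have mH := measurable_hitsE k; have mC := measurableC (mE k).
case: j => [|j]; first by rewrite setU0 addr0.
by apply: probU_le; exact: measurableI.
Qed.

(** Whatever the number of hits so far, the next event has conditional
    probability at least [q], and it multiplies the weight [z ^+ hits] by [z]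
    when it occurs; on average this costs a factor [1 - (1 - z) q]. The term
    that a hit shifts beyond the truncation at [N] is nonnegative. *)
Lemma generating_function_le (z : R) k N : 0 <= z <= 1 ->
  \sum_(j < N) z ^+ j * prob Pr [set w | hits E k w = j] <=
  (1 - (1 - z) * q) ^+ k.
Proof.
move=> /andP[z0 z1]; case/andP: q01 => q0 q1.
have rho0 : 0 <= 1 - (1 - z) * q.
  by rewrite subr_ge0 mulr_ile1// ?subr_ge0// lerBlDr lerDl.
elim: k N => [|k ih] [|N]; rewrite ?big_ord0 ?exprn_ge0//.
  rewrite big_ord_recl expr0 mul1r big1 => [|j _].
    by rewrite addr0 -(probT Pr) prob_le//; exact: measurable_hitsE.
  rewrite (_ : [set _ | _] = set0) ?/prob ?measure0 ?mulr0//.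
  by apply/seteqP; split=> w //=; rewrite /hits big_ord0.
pose H j := [set w | hits E k w = j].
have mH j : measurable (H j) by exact: measurable_hitsE.
apply: (@le_trans _ _ (\sum_(j < N.+1) z ^+ j * (prob Pr (H j `&` ~` E k)
    + z * prob Pr (H j `&` E k)))).
  apply: (@le_trans _ _ (\sum_(j < N.+1) z ^+ j * prob Pr (H j `&` ~` E k) +
      \sum_(j < N) z ^+ j.+1 * prob Pr (H j `&` E k))).
    apply: (@le_trans _ _ (\sum_(j < N.+1) z ^+ j * (prob Pr (H j `&` ~` E k)
        + if (j : nat) is j'.+1 then prob Pr (H j' `&` E k) else 0))).
      by apply: ler_sum => j _; rewrite ler_wpM2l ?exprn_ge0//; exact: prob_hits_eqS.
    under eq_bigr do rewrite mulrDr; rewrite big_split /= lerD2l.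
    by rewrite big_ord_recl mulr0 add0r.
  under [leRHS]eq_bigr do rewrite mulrDr mulrA -exprSr.
  rewrite big_split /= lerD2l [leRHS]big_ord_recr /= lerDl.
  by rewrite mulr_ge0 ?exprn_ge0// prob_ge0.
rewrite exprSr; apply: le_trans (ler_wpM2r rho0 (ih N.+1)).
rewrite mulr_suml; apply: ler_sum => j _; rewrite -mulrA ler_wpM2l ?exprn_ge0//.
have := prob_split Pr (mH j) (mE k); rewrite -/(H j).
have := hE k j; rewrite -/(H j).
move: (prob _ _) (prob _ _) (prob _ _) => a b c; nra.
Qed.

(** Markov's inequality for [z ^+ hits] with [z = exp (- delta)]. This [z] is
    not the optimal one, but it gives the exponent [delta ^ 2 / 2] through the
    elementary bound on [exp (- delta)]. *)
Lemma chernoff_hits m (delta : R) : 0 < delta < 1 ->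
  prob Pr [set w | (hits E m w)%:R < (1 - delta) * q * m%:R] <=
  expR (- (delta ^+ 2 / 2 * q * m%:R)).
Proof.
move=> /andP[d0 d1]; case/andP: (q01) => q0 q1.
set r := _ * m%:R; set z := expR (- delta).
have z01 : 0 <= z <= 1 by rewrite expR_ge0 expR_le1 oppr_le0 ltW.
pose B j := if j%:R < r then [set w | hits E m w = j] else set0.
have mB j : measurable (B j) by rewrite /B; case: ifP => // _; exact: measurable_hitsE.
have -> : [set w | (hits E m w)%:R < r] = \big[setU/set0]_(j < m.+1) B j.
  rewrite -bigcup_mkord; apply/seteqP; split=> [w /= wr|w [j /= jm]].
    by exists (hits E m w); [rewrite /= ltnS hits_le|rewrite /B wr].
  by rewrite /B; case: ifP => // jr /= ->.
apply: (@le_trans _ _ (\sum_(j < m.+1) prob Pr (B j))).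
  rewrite -lee_fin -probE; last by apply: bigsetU_measurable => j _.
  rewrite -sumEFin; under [leRHS]eq_bigr do rewrite -probE//.
  exact: Boole_inequality.
apply: (@le_trans _ _ (expR (delta * r) *
   \sum_(j < m.+1) z ^+ j * prob Pr [set w | hits E m w = j])).
  rewrite mulr_sumr; apply: ler_sum => j _; rewrite mulrA /B; case: ifP => jr.
    rewrite ler_peMl ?prob_ge0// /z -expRM_natr -expRD -[leLHS]expR0 ler_expR.
    by rewrite mulNr -mulrBr mulr_ge0 ?subr_ge0// ltW.
  by rewrite /prob measure0 mulr_ge0 ?prob_ge0// mulr_ge0 ?exprn_ge0 ?expR_ge0.
apply: le_trans (ler_wpM2l (expR_ge0 _) (generating_function_le m m.+1 z01)) _.
have rho : (1 - (1 - z) * q) ^+ m <= expR (- ((1 - z) * q) * m%:R).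
  rewrite expRM_natr lerXn2r ?nnegrE ?expR_ge0 ?expR_ge1Dx//.
  by case/andP: z01 => z0 z1; nra.
apply: le_trans (ler_wpM2l (expR_ge0 _) rho) _.
rewrite -expRD ler_expR /r -subr_ge0.
have := expRN_le (ltW d0); rewrite -/z => hz.
have -> : - (delta ^+ 2 / 2 * q * m%:R) - (delta * ((1 - delta) * q * m%:R) +
   - ((1 - z) * q) * m%:R) = (1 - delta + delta ^+ 2 / 2 - z) * (q * m%:R).
  by field.
by rewrite mulr_ge0 ?subr_ge0// mulr_ge0.
Qed.

End Bound.
End Chernoff.

(** * Decrease of one iteration *)

Section Algorithm.
Context {R : realType} {s n : nat} {f : 'cV[R]_n -> R}.
Hypotheses (hs : (0 < s)%N) (hf : twice_continuously_differentiable f).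
Context {gamma c1 c2 alpha beta : R}.
Hypotheses (hgamma : 0 <= gamma) (hc1 : 1 < c1) (hc2 : 0 < c2).
Hypotheses (halpha : 0 < alpha < 1) (hbeta : 0 < beta < 1).
Implicit Types (P : 'M[R]_(s, n)) (x : 'cV[R]_n).

Local Notation M P x := (reg_hess f gamma c1 c2 P x).
Local Notation dir P x := (direction f gamma c1 c2 P x).
Local Notation next P x := (next_iterate f gamma c1 c2 alpha beta P x).
Local Notation expo x d := (armijo_exponent f alpha beta x d).

Lemma sketched_hess_sym P x : (sketched_hess f P x)^T = sketched_hess f P x.
Proof. by rewrite /sketched_hess !trmx_mul trmxK hess_sym// mulmxA. Qed.

Lemma reg_hess_sym P x : (M P x)^T = M P x.
Proof. by rewrite /reg_hess linearD /= sketched_hess_sym tr_scalar_mx. Qed.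

Lemma dot_reg_hess P x v : dot v (M P x *m v) =
  dot v (sketched_hess f P x *m v) + eta_reg f gamma c1 c2 P x * dot v v.
Proof. by rewrite /reg_hess mulmxDl mul_scalar_mx dotDr dotZr. Qed.

Lemma Lambda_ge0 P x : 0 <= Lambda f P x.
Proof. by rewrite /Lambda le_max lexx. Qed.

(** The shift [c1 * Lambda] outweighs the negative curvature, since [c1 > 1]. *)
Lemma reg_hess_ge P x v :
  c2 * norm2 (grad f x) `^ gamma * dot v v <= dot v (M P x *m v).
Proof.
have [ray _] := lambda_min_attained hs (sketched_hess_sym P x).
rewrite dot_reg_hess; apply: le_trans (lerD (ray v) (lexx _)).
rewrite -mulrDl ler_wpM2r ?dot_ge0//.
have L1 : - lambda_min (sketched_hess f P x) <= Lambda f P x.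
  by rewrite /Lambda le_max lexx orbT.
have L2 : Lambda f P x <= c1 * Lambda f P x.
  by rewrite ler_peMl ?Lambda_ge0// ltW.
by rewrite /eta_reg; lra.
Qed.

Lemma directionE P x :
  dir P x = - (P^T *m (invmx (M P x) *m (P *m grad f x))).
Proof. by rewrite /direction !mulmxA. Qed.

Lemma dot_grad_direction P x : dot (grad f x) (dir P x) =
  - dot (P *m grad f x) (invmx (M P x) *m (P *m grad f x)).
Proof. by rewrite directionE dotNr dot_mulmx trmxK. Qed.

Lemma curvature_gt0 x : grad f x != 0 -> 0 < c2 * norm2 (grad f x) `^ gamma.
Proof.
move=> g0; rewrite mulr_gt0// powR_gt0// lt_neqAle norm2_ge0 andbT eq_sym.
by apply: contra g0 => /eqP/norm2_eq0/eqP.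
Qed.

(** With [u] solving the regularized system, [- g^T d = u^T M u] is at least a
    positive multiple of [|u|^2], and [d = - P^T u]. *)
Lemma direction_descent P x : grad f x != 0 ->
  dot (grad f x) (dir P x) <= 0 /\
  (dot (grad f x) (dir P x) = 0 -> dir P x = 0).
Proof.
move=> /curvature_gt0 a0; set a := _ * _ in a0.
have uM := pd_unitmx a0 (reg_hess_ge P x).
rewrite dot_grad_direction directionE; set u := invmx _ *m _.
have Mu : M P x *m u = P *m grad f x by rewrite mulKVmx.
have := reg_hess_ge P x u; rewrite -/a Mu dotC => ua.
split=> [|/eqP].
  by rewrite oppr_le0; apply: le_trans ua; rewrite mulr_ge0 ?dot_ge0 ?ltW.
rewrite oppr_eq0 => /eqP e; move: ua; rewrite e pmulr_rle0// => u0.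
by rewrite (@dot_eq0 _ _ u) ?mulmx0 ?oppr0//; apply/le_anti; rewrite u0 dot_ge0.
Qed.

Lemma armijo_gain x d l : armijo f alpha beta x d l <->
  alpha * beta ^+ l * - dot (grad f x) d <= f x - f (x + beta ^+ l *: d).
Proof. by rewrite /armijo -/(dot _ _) !mulNr mulrN. Qed.

(** The difference quotient along a descent direction tends to [dot g d], which
    is smaller than [alpha * dot g d] because [alpha < 1] and [dot g d < 0]. *)
Lemma armijo_exists x d : dot (grad f x) d < 0 ->
  exists l, armijo f alpha beta x d l.
Proof.
move=> gd; have [b0 b1] := andP hbeta; have [a0 a1] := andP halpha.
have df : differentiable f x by case: hf.
have cD : h^-1 *: (f (h *: d + x) - f x) @[h --> 0^'] --> dot (grad f x) d.
  rewrite -derive_grad//.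
  by have := @diff_derivable R _ _ f x d df; rewrite /derivable /derive.
have lt_gd : dot (grad f x) d < alpha * dot (grad f x) d by nra.
have quot := cvgr_lt _ cD _ lt_gd.
have cb : beta ^+ l @[l --> \oo] --> (0 : R).
  by apply: cvg_expr; rewrite ger0_norm// ltW.
have cb' : beta ^+ l @[l --> \oo] --> (0 : R)^'.
  move=> A /cb[N _ hN]; exists N => // l Nl; apply: (hN l Nl).
  by rewrite /= expf_neq0// gt_eqF.
have [N _ hN] := cb' _ (quot _).
exists N; apply/armijo_gain; have /= := hN N (leqnn N).
have bN : 0 < beta ^+ N by rewrite exprn_gt0.
rewrite /GRing.scale /= mulrC ltr_pdivrMr// addrC => h.
rewrite -[x + _]addrC; move: h; rewrite addrC; nra.
Qed.

Lemma armijo_exponentP x d : (exists l, armijo f alpha beta x d l) ->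
  armijo f alpha beta x d (expo x d) /\
  forall j, (j < expo x d)%N -> ~ armijo f alpha beta x d j.
Proof.
move=> [l al]; have ex : exists l, `[< armijo f alpha beta x d l >].
  by exists l; exact/asboolP.
have [k /asboolP ak kmin] := ex_minnP ex.
have exP : exists l, armijo f alpha beta x d l /\
    forall j, armijo f alpha beta x d j -> (l <= j)%N.
  by exists k; split=> // j aj; apply: kmin; exact/asboolP.
have [h1 h2] := xgetPex 0%N exP.
by split=> // j; rewrite ltnNge => /negP jl /h2.
Qed.

Lemma armijo_direction_exists P x : grad f x != 0 ->
  exists l, armijo f alpha beta x (dir P x) l.
Proof.
move=> g0; have [] := direction_descent P g0.
rewrite le_eqVlt => /orP[/eqP e /(_ e) d0|lt0 _]; last exact: armijo_exists.
exists 0%N; apply/armijo_gain.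
by rewrite d0 dot0r scaler0 addr0 subrr oppr0 mulr0.
Qed.

(** At a critical point the direction vanishes; elsewhere Armijo's rule holds
    along a direction of nonpositive slope. *)
Lemma next_iterate_le P x : f (next P x) <= f x.
Proof.
have [g0|g0] := eqVneq (grad f x) 0.
  rewrite /next_iterate /direction g0 !mulmx0 oppr0 scaler0 addr0.
  exact: lexx.
have [/armijo_gain h _] := armijo_exponentP (armijo_direction_exists P g0).
have [b0 b1] := andP hbeta; have [a0 a1] := andP halpha.
rewrite -subr_ge0; apply: le_trans h; rewrite mulr_ge0//.
  by rewrite mulr_ge0 ?exprn_ge0// ltW.
by rewrite oppr_ge0; case: (direction_descent P g0).
Qed.

Lemma iterate_level_set (P_ : nat -> 'M[R]_(s, n)) x0 k :
  level_set f x0 (iterate f gamma c1 c2 alpha beta P_ x0 k).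
Proof.
rewrite /level_set /=; elim: k => [|k ih]; first exact: lexx.
exact: le_trans (next_iterate_le _ _) ih.
Qed.

(** Backtracking loses at most one factor [beta] with respect to a step length
    [tau] below which every step is acceptable. *)
Lemma backtracking_step_ge x d tau :
  (exists l, armijo f alpha beta x d l) ->
  (forall t, 0 <= t <= 1 -> t <= tau ->
    alpha * t * - dot (grad f x) d <= f x - f (x + t *: d)) ->
  Num.min 1 (beta * tau) <= beta ^+ expo x d.
Proof.
move=> ex small; have [_] := armijo_exponentP ex.
have [b0 b1] := andP hbeta.
case: (expo x d) => [|l] lmin; first by rewrite expr0 ge_min lexx.
rewrite ge_min; apply/orP; right; rewrite exprS ler_pM2l//.
rewrite leNgt; apply/negP => lt_tau; apply: (lmin l (ltnSn l)).
apply/armijo_gain/small; last exact: ltW.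
by rewrite exprn_ge0 ?exprn_ile1// ltW.
Qed.

Section SufficientDecrease.
Context {C Ug UH eps : R} {P : 'M[R]_(s, n)} {x : 'cV[R]_n}.
Hypotheses (hn : (0 < n)%N) (C0 : 0 < C) (UH0 : 0 < UH) (eps0 : 0 < eps).
Local Notation g := (grad f x).
Let B := C * (n%:R / s%:R).
Local Notation r := (r_eps s n gamma c2 C Ug eps).
Hypotheses (g_ge : eps <= norm2 g) (g_le : norm2 g <= Ug).
Hypothesis gram : spectral_norm (P *m P^T) <= B.
Hypothesis jl : 2^-1 * norm2 g ^+ 2 <= norm2 (P *m g) ^+ 2.
Hypothesis curv : forall z, norm2 z <= r -> spectral_norm (hess f (x + z)) <= UH.

Let L := (1 + c1) * B * UH + c2 * Ug `^ gamma.
Let w := P *m g.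
Let d := dir P x.

Let s0 : 0 < s%:R :> R. Proof. by rewrite ltr0n. Qed.
Let n0 : 0 < n%:R :> R. Proof. by rewrite ltr0n. Qed.
Let B0 : 0 < B. Proof. by rewrite mulr_gt0 ?divr_gt0. Qed.
Let g0 : 0 < norm2 g. Proof. exact: lt_le_trans g_ge. Qed.
Let Ug0 : 0 < Ug. Proof. exact: lt_le_trans g_le. Qed.
Let L0 : 0 < L.
Proof.
rewrite /L addr_gt0// mulr_gt0// ?powR_gt0// mulr_gt0//.
by rewrite addr_gt0// (lt_trans _ hc1).
Qed.
Let gn0 : g != 0.
Proof. by apply/eqP => e; move: g0; rewrite e norm20 ltxx. Qed.

Lemma r_eps_ge0 : 0 <= r.
Proof.
rewrite /r_eps mulr_ge0//; first by rewrite divr_ge0 ?mulr_ge0 ?ltW// mulr_gt0.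
by rewrite le_max powR_ge0.
Qed.

(** [|P^T v|^2] is the quadratic form of the Gram matrix at [v]. *)
Lemma norm2_tr_sketch_sqr v : norm2 (P^T *m v) ^+ 2 <= B * norm2 v ^+ 2.
Proof.
rewrite !norm2_sqr dot_mulmx trmxK mulmxA dotC.
exact: le_trans (ler_norm _) (quad_form_le _ gram).
Qed.

(** A matrix and its transpose have the same norm; here this follows from
    [|P v|^2 = v^T P^T (P v) <= |v| |P^T (P v)|]. *)
Lemma norm2_sketch_sqr v : norm2 (P *m v) ^+ 2 <= B * norm2 v ^+ 2.
Proof.
have [->|pv] := eqVneq (norm2 (P *m v)) 0.
  by rewrite expr0n mulr_ge0 ?sqr_ge0// ltW.
have pv0 : 0 < norm2 (P *m v) ^+ 2 by rewrite exprn_gt0// lt_neqAle eq_sym pv norm2_ge0.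
rewrite -(ler_pM2l pv0) -expr2.
have h : norm2 (P *m v) ^+ 2 <= norm2 (P^T *m (P *m v)) * norm2 v.
  rewrite {1}norm2_sqr dot_mulmx.
  exact: le_trans (ler_norm _) (cauchy_schwarz _ _).
apply: (@le_trans _ _ ((norm2 (P^T *m (P *m v)) * norm2 v) ^+ 2)).
  by rewrite ler_pXn2r// nnegrE ?sqr_ge0// mulr_ge0 ?norm2_ge0.
rewrite exprMn [leRHS]mulrA; apply: ler_wpM2r; first exact: sqr_ge0.
rewrite [leRHS]mulrC; exact: norm2_tr_sketch_sqr.
Qed.

Lemma sketched_curvature_le v :
  `|dot v (sketched_hess f P x *m v)| <= B * UH * dot v v.
Proof.
have H0 : spectral_norm (hess f x) <= UH.
  by rewrite -[x]addr0; apply: curv; rewrite norm20 r_eps_ge0.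
have -> : dot v (sketched_hess f P x *m v) =
    dot (P^T *m v) (hess f x *m (P^T *m v)).
  by rewrite /sketched_hess -!mulmxA dot_mulmx.
apply: le_trans (quad_form_le _ H0) _.
rewrite [B * UH]mulrC -mulrA -!norm2_sqr; apply: ler_wpM2l; first exact: ltW.
exact: norm2_tr_sketch_sqr.
Qed.

Lemma Lambda_le : Lambda f P x <= B * UH.
Proof.
have BU0 : 0 <= B * UH by rewrite mulr_ge0// ltW.
rewrite /Lambda ge_max BU0 /=.
have [_ [v v1 <-]] := lambda_min_attained hs (sketched_hess_sym P x).
have := sketched_curvature_le v; rewrite v1 mulr1; apply: le_trans.
by rewrite -normrN ler_norm.
Qed.

Lemma powR_grad_le : norm2 g `^ gamma <= Ug `^ gamma.
Proof. by apply: ge0_ler_powR; rewrite ?nnegrE ?norm2_ge0// ltW. Qed.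

Lemma reg_hess_le v : dot v (M P x *m v) <= L * dot v v.
Proof.
rewrite dot_reg_hess; have vv := dot_ge0 v.
have h1 := le_trans (ler_norm _) (sketched_curvature_le v).
have h2 : eta_reg f gamma c1 c2 P x <= c1 * (B * UH) + c2 * Ug `^ gamma.
  rewrite /eta_reg lerD//; first by rewrite ler_pM2l ?Lambda_le// (lt_trans _ hc1).
  by rewrite ler_pM2l// powR_grad_le.
have -> : L * dot v v =
    B * UH * dot v v + (c1 * (B * UH) + c2 * Ug `^ gamma) * dot v v.
  by rewrite /L; ring.
by apply: lerD => //; rewrite ler_wpM2r.
Qed.

Lemma slope_ge : norm2 w ^+ 2 / L <= - dot g d.
Proof.
rewrite dot_grad_direction opprK.
exact: (pd_solve_ge w (curvature_gt0 gn0) L0 (reg_hess_sym P x)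
  (reg_hess_ge P x) reg_hess_le).
Qed.

Lemma norm2_direction_sqr : norm2 d ^+ 2 <=
  B * (norm2 w ^+ 2 / (c2 * norm2 g `^ gamma) ^+ 2).
Proof.
rewrite /d directionE norm2N; apply: le_trans (norm2_tr_sketch_sqr _) _.
apply: ler_wpM2l; first exact: ltW.
rewrite -expr_div_n ler_pXn2r ?nnegrE ?norm2_ge0//; last first.
  by rewrite divr_ge0 ?norm2_ge0// ltW// curvature_gt0.
exact: pd_solve_le (curvature_gt0 gn0) (reg_hess_ge P x).
Qed.

(** The radius [r_eps] is chosen for this: the trial points stay where the
    Hessian is bounded by [UH]. The two terms of its maximum cover the cases
    [gamma <= 1], where [|g| <= Ug] is used, and [gamma > 1], where [eps <= |g|]
    is. *)
Lemma norm2_direction_le : norm2 d <= r.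
Proof.
have a0 := curvature_gt0 gn0.
have h : norm2 d <= B * norm2 g / (c2 * norm2 g `^ gamma).
  rewrite -ler_sqr ?nnegrE ?norm2_ge0//; last first.
    by rewrite divr_ge0 ?(ltW a0)// mulr_ge0 ?norm2_ge0 ?(ltW B0).
  apply: le_trans norm2_direction_sqr _.
  rewrite expr_div_n mulrA; apply: ler_wpM2r; first by rewrite invr_ge0 sqr_ge0.
  have -> : (B * norm2 g) ^+ 2 = B * (B * norm2 g ^+ 2) by ring.
  apply: ler_wpM2l; first exact: ltW.
  exact: norm2_sketch_sqr.
apply: le_trans h _.
have -> : B * norm2 g / (c2 * norm2 g `^ gamma) =
    C * n%:R / (c2 * s%:R) * norm2 g `^ (1 - gamma).
  rewrite powRB ?(gt_eqF g0) ?implybT// powRr1 ?norm2_ge0//.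
  by rewrite /B; field; rewrite !gt_eqF// powR_gt0.
rewrite /r_eps; apply: ler_wpM2l.
  by rewrite divr_ge0 ?mulr_ge0// ltW// mulr_gt0.
rewrite le_max; have [g1|g1] := leP gamma 1.
  by rewrite ge0_ler_powR ?subr_ge0 ?nnegrE ?norm2_ge0// ltW.
apply/orP; right; rewrite -opprB powRN div1r.
rewrite lef_pV2 ?posrE ?powR_gt0//.
apply: ge0_ler_powR; rewrite ?subr_ge0 ?nnegrE ?norm2_ge0//; exact: ltW.
Qed.

Let a := c2 * eps `^ gamma.
Let a0 : 0 < a. Proof. by rewrite mulr_gt0// powR_gt0. Qed.

Lemma norm2_direction_sqr_le : norm2 d ^+ 2 <= B * norm2 w ^+ 2 / a ^+ 2.
Proof.
apply: le_trans norm2_direction_sqr _; rewrite -mulrA.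
apply: ler_wpM2l; first exact: ltW.
apply: ler_wpM2l; first exact: sqr_ge0.
rewrite lef_pV2 ?posrE ?exprn_gt0 ?curvature_gt0//.
rewrite ler_pXn2r ?nnegrE ?(ltW a0) ?(ltW (curvature_gt0 gn0))//.
rewrite /a ler_pM2l//; apply: ge0_ler_powR => //; rewrite nnegrE ?norm2_ge0//.
exact: ltW.
Qed.

(* For steps up to [tau], the quadratic term of Taylor's bound is at most the
   fraction [1 - alpha] of the linear one. *)
Let tau := 2 * (1 - alpha) * a ^+ 2 / (L * UH * B).

Lemma small_step_acceptable t : 0 <= t <= 1 -> t <= tau ->
  alpha * t * - dot g d <= f x - f (x + t *: d).
Proof.
move=> t01 ttau; have /andP[t0 t1] := t01.
have [al0 al1] := andP halpha.
have tay := @taylor_upper_bound _ _ _ hf x d (UH * norm2 d ^+ 2) _ t t01.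
have {}tay : f (x + t *: d) <= f x + t * dot g d + t ^+ 2 / 2 * (UH * norm2 d ^+ 2).
  apply: tay => r /andP[r0 r1]; rewrite norm2_sqr.
  apply: le_trans (ler_norm _) (quad_form_le _ (curv _)).
  rewrite norm2Z ger0_norm//; apply: le_trans norm2_direction_le.
  by rewrite ler_piMl ?norm2_ge0.
have key : t / 2 * (UH * norm2 d ^+ 2) <= (1 - alpha) * - dot g d.
  apply: (@le_trans _ _ ((1 - alpha) * (norm2 w ^+ 2 / L))); last first.
    by apply: ler_wpM2l slope_ge; rewrite subr_ge0 ltW.
  apply: (@le_trans _ _ (tau / 2 * (UH * (B * norm2 w ^+ 2 / a ^+ 2)))).
    apply: ler_pM; first by rewrite divr_ge0.
    - by rewrite mulr_ge0 ?sqr_ge0 ?(ltW UH0).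
    - by rewrite ler_pM2r// invr_gt0.
    by apply: ler_wpM2l norm2_direction_sqr_le; exact: ltW.
  rewrite /tau le_eqVlt; apply/orP; left; apply/eqP; field.
  by rewrite !gt_eqF.
by move: (ler_wpM2l t0 key) tay; lra.
Qed.

Lemma t_minE : t_min s n gamma c1 c2 alpha beta C Ug UH eps =
  Num.min 1 (beta * tau).
Proof.
have LE : (1 + c1) * (C * n%:R / s%:R) * UH + c2 * Ug `^ gamma = L.
  by rewrite /L /B !mulrA.
rewrite /t_min LE; congr Num.min; rewrite /tau /a /B.
have -> : eps `^ (2 * gamma) = (eps `^ gamma) ^+ 2.
  by rewrite mulrC powRrM powR_mulrn ?powR_ge0.
by field; rewrite !gt_eqF.
Qed.

(** Armijo's rule gains [alpha * t] times the slope. Backtracking keeps the step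
    above [t_min], and the slope is at least [|P g|^2 / L >= eps^2 / (2 L)]. *)
Lemma sufficient_decrease :
  p_eps s n gamma c1 c2 alpha beta C Ug UH eps * eps ^+ 2 <= f x - f (next P x).
Proof.
have ex := armijo_direction_exists P gn0.
have [al0 al1] := andP halpha.
have step := backtracking_step_ge ex small_step_acceptable.
rewrite -t_minE in step; set t := t_min _ _ _ _ _ _ _ _ _ _ _ in step.
have t0 : 0 <= t.
  rewrite /t t_minE le_min ler01 mulr_ge0 ?(ltW (andP hbeta).1)//.
  rewrite /tau divr_ge0//.
    by rewrite mulr_ge0 ?sqr_ge0// mulr_ge0// subr_ge0 ltW.
  by rewrite mulr_ge0 ?(ltW B0)// mulr_ge0 ?(ltW L0) ?(ltW UH0).
have pE : p_eps s n gamma c1 c2 alpha beta C Ug UH eps = alpha * t / (2 * L).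
  rewrite /p_eps -/t; congr (_ / _); rewrite /L /B.
  by field; rewrite gt_eqF.
have [/armijo_gain + _] := armijo_exponentP ex; apply: le_trans.
have slope : eps ^+ 2 / (2 * L) <= - dot g d.
  apply: le_trans slope_ge; rewrite invfM mulrA; apply: ler_wpM2r.
    by rewrite invr_ge0 ltW.
  apply: le_trans jl; rewrite mulrC ler_pM2l ?invr_gt0//.
  by rewrite ler_pXn2r ?nnegrE ?norm2_ge0// ltW.
rewrite pE.
have -> : alpha * t / (2 * L) * eps ^+ 2 = alpha * t * (eps ^+ 2 / (2 * L)) by ring.
apply: ler_pM => //; first by rewrite mulr_ge0// ltW.
  by rewrite divr_ge0 ?sqr_ge0// mulr_ge0// ltW.
by rewrite ler_pM2l.
Qed.

End SufficientDecrease.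
End Algorithm.

(** * Measurability of the iterates *)

Section MeasurableIterates.
Context {R : realType} {s n : nat} {f : 'cV[R]_n -> R}.
Hypotheses (hs : (0 < s)%N) (hf : twice_continuously_differentiable f).
Context {gamma c1 c2 alpha beta : R}.
Context {d : measure_display} {T : measurableType d}.
Context {P : T -> 'M[R]_(s, n)} {x : T -> 'cV[R]_n}.
Hypotheses (mP : measurable_mx P) (mx : measurable_mx x).

Lemma measurable_grad : measurable_mx (fun w => grad f (x w)).
Proof. by apply: measurable_mx_continuous_comp => //; exact: grad_continuous. Qed.

Lemma measurable_sketched_hess : measurable_mx (fun w => sketched_hess f (P w) (x w)).
Proof.
apply: measurable_mx_mul; last exact: measurable_mx_tr.
apply: measurable_mx_mul => //.
by apply: measurable_mx_continuous_comp => //; exact: hess_continuous.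
Qed.

Lemma measurable_reg_hess :
  measurable_mx (fun w => reg_hess f gamma c1 c2 (P w) (x w)).
Proof.
apply: measurable_mx_add; first exact: measurable_sketched_hess.
apply: measurable_mx_scalar; apply: measurable_funD.
  apply: measurable_funM; first exact: measurable_cst.
  apply: measurable_maxr; first exact: measurable_cst.
  apply: measurable_funN; apply: measurable_lambda_min => //.
    by move=> w; exact: sketched_hess_sym.
  exact: measurable_sketched_hess.
apply: measurable_funM; first exact: measurable_cst.
exact: (@measurable_comp _ _ _ _ _ _ setT (fun y : R => y `^ gamma) setT
  (fun w => norm2 (grad f (x w))) measurableT (fun _ _ => I)
  (@measurable_powR R gamma) (measurable_norm2 measurable_grad)).
Qed.

Let dir w := direction f gamma c1 c2 (P w) (x w).

Lemma measurable_direction : measurable_mx dir.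
Proof.
apply: measurable_mx_opp; apply: measurable_mx_mul; last exact: measurable_grad.
apply: measurable_mx_mul => //; apply: measurable_mx_mul.
  exact: measurable_mx_tr.
exact/measurable_invmx/measurable_reg_hess.
Qed.

Lemma measurable_armijo l : measurable [set w | armijo f alpha beta (x w) (dir w) l].
Proof.
have mstep : measurable_mx (fun w => x w + beta ^+ l *: dir w).
  apply: measurable_mx_add => //.
  by apply: measurable_mx_scale measurable_direction; exact: measurable_cst.
have mf (y : T -> 'cV[R]_n) : measurable_mx y -> measurable_fun setT (fun w => f (y w)).
  by apply: measurable_continuous_comp; exact: C2_continuous.
apply: measurable_ler; last by apply: measurable_funB; exact: mf.
apply: measurable_funM; first exact: measurable_cst.
exact: measurable_dot measurable_grad measurable_direction.
Qed.

(** The exponent is 0 also when no exponent is acceptable, which gives the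
    second term of the union. *)
Lemma measurable_armijo_exponent l :
  measurable [set w | armijo_exponent f alpha beta (x w) (dir w) = l].
Proof.
pose arm w := armijo f alpha beta (x w) (dir w).
have -> : [set w | armijo_exponent f alpha beta (x w) (dir w) = l] =
   ([set w | arm w l] `&` [set w | forall j : 'I_l, ~ arm w j]) `|`
   (if l == 0%N then [set w | forall j, ~ arm w j] else set0).
  apply/seteqP; split=> w /=.
    have [ex|nex] := pselect (exists j, arm w j).
      have [h1 h2] := armijo_exponentP ex => <-.
      by left; split => // j; exact: h2.
    move=> e; right; have -> : l = 0%N.
      rewrite -e; apply: xgetPN => j [aj _]; apply: nex; by exists j.
    by move=> /= j aj; apply: nex; exists j.
  case=> [[al lmin]|].
    have [h1 h2] : _ /\ _ := armijo_exponentP (ex_intro _ l al).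
    apply/eqP; rewrite eqn_leq; apply/andP; split.
      by rewrite leqNgt; apply/negP => /h2.
    by rewrite leqNgt; apply/negP => lt; exact: (lmin (Ordinal lt)).
  case: eqP => // -> /= nar; apply: xgetPN => j [aj _]; exact: nar aj.
have mar j : measurable [set w | arm w j] by exact: measurable_armijo.
have mnar j : measurable [set w | ~ arm w j] by exact: measurableC (mar j).
apply: measurableU; first by apply: measurableI => //; exact: measurable_forall.
by case: eqP => // _; exact: measurable_forall.
Qed.

Lemma measurable_next_iterate : measurable_mx
  (fun w => next_iterate f gamma c1 c2 alpha beta (P w) (x w)).
Proof.
move=> i j.
apply: (@measurable_nat_select _ _ _ (fun w => armijo_exponent f alpha beta (x w) (dir w))
  (fun l w => (x w + beta ^+ l *: dir w) i j)); first exact: measurable_armijo_exponent.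
move=> l; apply: (measurable_mx_add mx).
by apply: measurable_mx_scale measurable_direction; exact: measurable_cst.
Qed.

End MeasurableIterates.

(** * Good sketches *)

Section GoodSketch.
Context {R : realType}.

(** What the decrease at the gradient [v] requires of a sketch [M]. The factor
    1/2 is one minus the Johnson-Lindenstrauss distortion used below. *)
Definition good_sketch {s n} (B : R) (M : 'M[R]_(s, n)) (v : 'cV[R]_n) : Prop :=
  2^-1 * norm2 v ^+ 2 <= norm2 (M *m v) ^+ 2 /\ spectral_norm (M *m M^T) <= B.

(** Closedness in the vector is what lets the freezing lemma pass to the limit. *)
Lemma good_sketch_closed s n B (M : 'M[R]_(s, n)) : closed [set v | good_sketch B M v].
Proof.
apply: closedI; last first.
  have [h|h] := pselect (spectral_norm (M *m M^T) <= B).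
    have -> : (fun=> spectral_norm (M *m M^T) <= B : Prop) = @setT 'cV[R]_n.
      by apply/seteqP; split.
    exact: closedT.
  have -> : (fun=> spectral_norm (M *m M^T) <= B : Prop) = @set0 'cV[R]_n.
    by apply/seteqP; split.
  exact: closed0.
rewrite (_ : (fun _ => _) = (fun v => dot (M *m v) (M *m v) - 2^-1 * dot v v) @^-1`
    [set r | 0 <= r]); last first.
  by apply/seteqP; split=> v /=; rewrite !norm2_sqr subr_ge0.
apply: preimage_closed; last exact: closed_ge.
move=> v _; apply: (@cvgB _ _ _ (nbhs v)).
  by apply: dot_continuous; exact: mulmx_continuous.
apply: (@cvgM _ _ (nbhs v)); first exact: cvg_cst.
by apply: dot_continuous => u; exact: cvg_id.
Qed.

Lemma measurable_good_sketch s n B {d : measure_display} {T : measurableType d}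
    (Z : T -> 'M[R]_(s, n)) (G : T -> 'cV[R]_n) : 0 <= B ->
  measurable_mx Z -> measurable_mx G -> measurable [set w | good_sketch B (Z w) (G w)].
Proof.
move=> B0 mZ mG; apply: measurableI.
  apply: measurable_ler.
    apply: measurable_funM; first exact: measurable_cst.
    exact/measurable_funX/measurable_norm2.
  exact/measurable_funX/measurable_norm2/measurable_mx_mul.
apply: measurable_spectral_norm_le => //; apply: measurable_mx_mul => //.
exact: measurable_mx_tr.
Qed.

End GoodSketch.

Lemma p_eps_gt0 {R : realType} (s n : nat) (gamma c1 c2 alpha beta C Ug UH eps : R) :
  (0 < s)%N -> (0 < n)%N -> 1 < c1 -> 0 < c2 -> 0 < alpha < 1 -> 0 < beta < 1 ->
  0 < C -> 0 < Ug -> 0 < UH -> 0 < eps ->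
  0 < p_eps s n gamma c1 c2 alpha beta C Ug UH eps.
Proof.
move=> s0 n0 hc1 hc2 /andP[a0 a1] /andP[b0 b1] C0 Ug0 UH0 eps0.
have s0' : 0 < s%:R :> R by rewrite ltr0n.
have n0' : 0 < n%:R :> R by rewrite ltr0n.
have c10 : 0 < 1 + c1 by lra.
have a10 : 0 < 1 - alpha by rewrite subr_gt0.
have u0 : 0 < Ug `^ gamma by exact: powR_gt0.
have e0 : 0 < eps `^ (2 * gamma) by exact: powR_gt0.
rewrite /p_eps divr_gt0//; last by rewrite addr_gt0// !mulr_gt0// invr_gt0.
rewrite mulr_gt0// /t_min lt_min ltr01 divr_gt0//.
  by rewrite !mulr_gt0// exprn_gt0.
rewrite !mulr_gt0// addr_gt0// !mulr_gt0// invr_gt0//.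
Qed.

(** Compactness of the level set; without a lower bound the infimum of [f]
    would carry no information. *)
Lemma level_set_lbound {R : realType} n (f : 'cV[R]_n -> R) x0 : continuous f ->
  bounded_set (level_set f x0) -> has_lbound (f @` level_set f x0).
Proof.
move=> cf bO; have cO : compact (level_set f x0).
  apply: bounded_closed_compact_cV => //.
  by apply: (@preimage_closed _ _ f [set y | y <= f x0]) => [x _|];
    [exact: cf|exact: closed_le].
have O0 : level_set f x0 !=set0 by exists x0; rewrite /level_set /= lexx.
have [c _ cmin] := compact_EVT_min O0 cO (continuous_subspaceT cf).
by exists (f c) => _ [y Oy <-]; apply: cmin; rewrite inE.
Qed.

(** * Iteration complexity *)

Section Convergence.
Context {R : realType} {s n : nat} (hs : (0 < s)%N) (hsn : (s < n)%N).
Context {f : 'cV[R]_n -> R} (hf : twice_continuously_differentiable f).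
Context {x0 : 'cV[R]_n} {gamma c1 c2 alpha beta : R}.
Hypotheses (hgamma : 0 <= gamma) (hc1 : 1 < c1) (hc2 : 0 < c2).
Hypotheses (halpha : 0 < alpha < 1) (hbeta : 0 < beta < 1).
Context {d : measure_display} {T : measurableType d} {Pr : probability T R}.
Context {X : nat -> 'I_s * 'I_n -> {RV Pr >-> R}}.
Local Notation index := (nat * ('I_s * 'I_n))%type.
Let Y (q : index) := X q.1 q.2.
Hypothesis hX : iid_centered_normal s%:R^-1 Y.
Context {C0 C : R} (hC0 : jl_constant C0) (hC : gram_constant s n C).
Let B := C * (n%:R / s%:R).
Let q := 1 - delta_s C0 s.
Hypothesis q0 : 0 <= q.

Let P k w := random_mx (X k) w.
Let x k w := iterate f gamma c1 c2 alpha beta (fun i => P i w) x0 k.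
Let E k := [set w | good_sketch B (P k w) (grad f (x k w))].

(** The first [k] sketches determine the iterate [x_k]. Their variables are listed
    because independence is stated over duplicate-free lists of indices. *)
Definition history (k : nat) : seq index :=
  [seq (i, ij) | i <- iota 0 k, ij <- enum {: 'I_s * 'I_n}].

Definition current (k : nat) : seq index := [seq (k, ij) | ij <- enum {: 'I_s * 'I_n}].

Lemma mem_history k i ij : ((i, ij) \in history k) = (i < k)%N.
Proof.
apply/allpairsP/idP => [[[i' ij'] /= [+ _ [-> _]]]|ik]; first by rewrite mem_iota.
by exists (i, ij); rewrite mem_iota mem_enum.
Qed.

Lemma mem_current k i ij : ((i, ij) \in current k) = (i == k).
Proof.
apply/mapP/eqP => [[ij' _ [-> _]]|->]//.
by exists ij => //; rewrite mem_enum.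
Qed.

Lemma uniq_history_current k : uniq (history k ++ current k).
Proof.
rewrite cat_uniq; apply/and3P; split.
- by rewrite allpairs_uniq ?iota_uniq ?enum_uniq// => -[a b] [a' b'] _ _ [-> ->].
- apply/hasPn => -[i ij]; rewrite mem_current => /eqP ->.
  by rewrite /= mem_history ltnn.
- by rewrite map_inj_uniq ?enum_uniq// => a b [].
Qed.

Local Notation sigma J := (g_sigma_algebraType (cylinders Y J)).

Lemma measurable_sketch (J : seq index) k : {subset current k <= J} ->
  measurable_mx (P k : sigma J -> 'M[R]_(s, n)).
Proof.
move=> kJ i j; rewrite (_ : (fun _ => _) = Y (k, (i, j))).
  by apply: measurable_generated; apply: kJ; rewrite mem_current.
by apply/funext => w; rewrite /P mxE.
Qed.

Lemma measurable_sigma_mono (J K : seq index) a b (F : T -> 'M[R]_(a, b)) :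
  {subset J <= K} -> measurable_mx (F : sigma J -> 'M[R]_(a, b)) ->
  measurable_mx (F : sigma K -> 'M[R]_(a, b)).
Proof.
move=> JK mF i j _ D mD; apply: (generated_mono JK).
by have := mF i j measurableT D mD.
Qed.

Lemma history_mono i k : (i <= k)%N -> {subset history i <= history k}.
Proof.
by move=> ik [j ij]; rewrite !mem_history => /leq_trans; apply.
Qed.

Lemma current_history i k : (i < k)%N -> {subset current i <= history k}.
Proof. by move=> ik [j ij]; rewrite mem_current mem_history => /eqP ->. Qed.

Lemma measurable_iterate k : measurable_mx (x k : sigma (history k) -> 'cV[R]_n).
Proof.
elim: k => [|k ih]; first exact: measurable_mx_cst.
apply: measurable_next_iterate => //.
  by apply: measurable_sketch; exact: current_history.
by apply: measurable_sigma_mono ih; exact: history_mono.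
Qed.

Let B0 : 0 <= B.
Proof. by case: hC => C1 _; rewrite mulr_ge0 ?divr_ge0// ltW. Qed.

Lemma measurable_good_step i k : (i < k)%N ->
  (<<s cylinders Y (history k) >> : set (set T)) (E i).
Proof.
move=> ik; apply: (@measurable_good_sketch R s n B _ (sigma (history k))) => //.
  by apply: measurable_sketch; exact: current_history.
apply: measurable_grad => //.
apply: (@measurable_sigma_mono (history i) (history k)).
  exact/history_mono/ltnW.
exact: measurable_iterate.
Qed.

Lemma iid_sketch k : iid_centered_normal s%:R^-1 (X k).
Proof.
case: hX => ind law; split=> [J D uJ mD|ij D mD]; last exact: (law (k, ij)).
have := ind [seq (k, ij) | ij <- J] (fun p => D p.2).
rewrite !big_map; apply=> //.
by rewrite map_inj_uniq// => a b [].
Qed.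

Lemma measurable_T_sketch k : measurable_mx (P k).
Proof.
by apply: (@measurable_mx_generated _ _ _ _ _ Y (current k)); exact: measurable_sketch.
Qed.

(** Union bound. The Johnson-Lindenstrauss property is used with distortion 1/2,
    whence the exponent [C0 / 4]. *)
Lemma good_sketch_prob k v : (q%:E <= Pr [set w | good_sketch B (P k w) v])%E.
Proof.
have mP := measurable_T_sketch k.
have half : 0 < (2^-1 : R) < 1 by apply/andP; split; lra.
have [_ /(_ s n _ _ Pr (X k) hs (iid_sketch k) v _ half) hJL] := hC0.
have [_ /(_ _ _ Pr (X k) (iid_sketch k)) hG] := hC.
set A1 := [set w | _] in hJL; set A2 := [set w | _] in hG.
have mPv : measurable_fun setT (fun w => norm2 (P k w *m v) ^+ 2).
  apply/measurable_funX/measurable_norm2.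
  by apply: (@measurable_mx_mul R _ T _ _ _ (P k) (fun=> v)) => //; exact: measurable_mx_cst.
have m1 : measurable A1.
  rewrite (_ : A1 = [set w | (1 - 2^-1) * norm2 v ^+ 2 <= norm2 (P k w *m v) ^+ 2] `&`
      [set w | norm2 (P k w *m v) ^+ 2 <= (1 + 2^-1) * norm2 v ^+ 2]).
    by apply: measurableI; apply: measurable_ler => //; exact: measurable_cst.
  by apply/seteqP; split=> w /= => [/andP|[? ?]]//; apply/andP.
have m2 : measurable A2.
  apply: measurable_spectral_norm_le => //; apply: measurable_mx_mul => //.
  exact: measurable_mx_tr.
have mG : measurable [set w | good_sketch B (P k w) v].
  by apply: measurable_good_sketch => //; exact: measurable_mx_cst.
rewrite probE// lee_fin.
have sub : A1 `&` A2 `<=` [set w | good_sketch B (P k w) v].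
  move=> w [/= /andP[h _] ?]; split=> //; apply: le_trans h.
  by rewrite [X in X * _ <= _](_ : _ = 1 - 2^-1)//; lra.
apply: le_trans (prob_le Pr _ mG sub); last exact: measurableI.
have h1 : 1 - 2 * expR (- (C0 * 2^-1 ^+ 2 * s%:R)) <= prob Pr A1.
  by rewrite -lee_fin -probE.
have h2 : 1 - 2 * expR (- s%:R) <= prob Pr A2 by rewrite -lee_fin -probE.
have h3 := prob_split Pr m1 m2.
have h4 : prob Pr (A1 `&` ~` A2) <= prob Pr (~` A2).
  apply: prob_le; [|exact: measurableC|by move=> w []].
  by apply: measurableI => //; exact: measurableC.
rewrite probC// in h4.
have C04 : C0 * 2^-1 ^+ 2 * s%:R = C0 / 4 * s%:R by field.
rewrite C04 in h1; rewrite /q /delta_s.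
move: h1 h2 h3 h4; move: (expR _) (expR _) (prob _ _) (prob _ _) (prob _ _) (prob _ _).
by move=> *; lra.
Qed.

(** The current gradient depends on the past sketches only, so it can be frozen. *)
Lemma good_step_conditional k A : <<s cylinders Y (history k) >> A ->
  q * prob Pr A <= prob Pr (A `&` E k).
Proof.
move=> sA; have mA := generated_measurable sA.
have mE : measurable (E k).
  exact: (generated_measurable (measurable_good_step (ltnSn k))).
have := @freezing R d T Pr _ Y (history k) (current k) s n n (good_sketch B) (P k)
  (fun w => grad f (x k w)) A q (proj1 hX) (uniq_history_current k) q0.
rewrite -lee_fin EFinM -!probE//; last exact: measurableI.
apply=> //.
- apply: (@measurable_mx_continuous_comp R _ (sigma (history k)) _ _ _ _ (grad f)).
    exact: grad_continuous.
  exact: measurable_iterate.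
- move=> v; apply: (@measurable_good_sketch R s n B _ (sigma (current k))) => //.
  exact: measurable_sketch.
- exact: good_sketch_prob.
- by move=> M; exact: good_sketch_closed.
Qed.

(** Telescoping: good steps gain [p_eps * eps ^+ 2] while the gradient is large,
    and the other steps do not increase [f]. *)
Lemma decrease_ge_hits {Ug UH eps : R} m w : 0 < eps -> 0 < UH ->
  (forall k, norm2 (grad f (x k w)) <= Ug) ->
  (forall y z : 'cV[R]_n, level_set f x0 y ->
     norm2 z <= r_eps s n gamma c2 C Ug eps -> spectral_norm (hess f (y + z)) <= UH) ->
  (forall k, (k < m)%N -> eps <= norm2 (grad f (x k w))) ->
  (hits E m w)%:R * (p_eps s n gamma c1 c2 alpha beta C Ug UH eps * eps ^+ 2)
    <= f x0 - f (x m w).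
Proof.
move=> eps0 UH0 hUg hUH; elim: m => [|k ih] big.
  by rewrite /hits big_ord0 mul0r subrr.
have {}ih := ih (fun i ik => big i (ltnW ik)).
have big_k := big k (ltnSn k).
set p := p_eps _ _ _ _ _ _ _ _ _ _ _ * _ in ih *.
have next_le : f (x k.+1 w) <= f (x k w) by exact: next_iterate_le.
rewrite hitsS natrD mulrDl; case: asboolP => [[jl gram]|_]; last first.
  by rewrite mul0r addr0; lra.
suff : p <= f (x k w) - f (x k.+1 w) by rewrite mul1r; lra.
apply: (sufficient_decrease hs hf hgamma hc1 hc2 halpha hbeta) => //.
- exact: leq_ltn_trans hsn.
- by case: hC.
- by move=> z; apply: hUH; exact: iterate_level_set.
Qed.

End Convergence.

Theorem theorem4p6
  (R : realType) (s n : nat) (hs : (0 < s)%N) (hsn : (s < n)%N)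
  (f : 'cV[R]_n -> R) (hf : twice_continuously_differentiable f)
  (x0 : 'cV[R]_n) (gamma c1 c2 alpha beta : R)
  (hgamma : 0 <= gamma) (hc1 : 1 < c1) (hc2 : 0 < c2)
  (halpha : 0 < alpha < 1) (hbeta : 0 < beta < 1)
  (d : measure_display) (T : measurableType d) (Pr : probability T R)
  (X : nat -> 'I_s * 'I_n -> {RV Pr >-> R})
  (hX : iid_centered_normal s%:R^-1
          (fun q : nat * ('I_s * 'I_n) => X q.1 q.2))
  (x : nat -> T -> 'cV[R]_n)
  (hx : forall k w, x k w =
     iterate f gamma c1 c2 alpha beta (fun i => random_mx (X i) w) x0 k)
  (C0 : R) (hC0 : jl_constant C0)
  (C : R) (hC : gram_constant s n C)
  (hOmega : bounded_set (level_set f x0))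
  (eps : R) (heps : 0 < eps)
  (Ug : R) (hUg0 : 0 < Ug) (hUg : forall k w, norm2 (grad f (x k w)) <= Ug)
  (UH : R) (hUH0 : 0 < UH)
  (hUH : forall y z : 'cV[R]_n, level_set f x0 y ->
     norm2 z <= r_eps s n gamma c2 C Ug eps ->
     spectral_norm (hess f (y + z)) <= UH)
  (delta : R) (hdelta : 0 < delta < 1)
  (hdelta_s : delta_s C0 s < 1)
  (m : nat)
  (hm : m%:Z = Num.floor
     ((f x0 - inf (f @` level_set f x0)) /
      ((1 - delta) * (1 - delta_s C0 s)
       * p_eps s n gamma c1 c2 alpha beta C Ug UH eps * eps ^+ 2)) + 1) :
  ((1 - expR (- (delta ^+ 2 / 2 * (1 - delta_s C0 s) * m%:R)))%:E <=
   Pr [set w | exists2 k : nat, (k < m)%N & (norm2 (grad f (x k w)) < eps)%R])%E.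
Proof.
pose y k w := iterate f gamma c1 c2 alpha beta (fun i => random_mx (X i) w) x0 k.
have xE : x = y by apply/funext => k; apply/funext => w; rewrite hx.
move: hUg; rewrite {}xE {x hx} => hUg.
have [d0 d1] := andP hdelta.
set q := 1 - delta_s C0 s in hm *.
have q0 : 0 < q by rewrite subr_gt0.
have q1 : q <= 1.
  by rewrite /q gerBl /delta_s mulr_ge0// addr_ge0// expR_ge0.
set Y := (fun q : nat * ('I_s * 'I_n) => X q.1 q.2) in hX.
pose E k := [set w | good_sketch (C * (n%:R / s%:R)) (random_mx (X k) w) (grad f (y k w))].
have sE k i : (i < k)%N -> (<<s cylinders Y (@history s n k) >> : set (set T)) (E i).
  exact: (measurable_good_step hs hf hC).
have mE k : measurable (E k) by exact: (generated_measurable (sE k.+1 k (ltnSn k))).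
have cond k j : q * prob Pr [set w | hits E k w = j] <=
    prob Pr ([set w | hits E k w = j] `&` E k).
  apply: (good_step_conditional hs hf hX hC0 hC (ltW q0)).
  apply: (@measurable_hits _ (g_sigma_algebraType (cylinders Y (@history s n k)))).
  by move=> i; exact: sE.
have tail := chernoff_hits mE (introT andP (conj (ltW q0) q1)) cond m hdelta.
have my k : measurable_mx (y k).
  apply: (@measurable_mx_generated _ _ _ _ _ Y (@history s n k)).
  exact: measurable_iterate.
set S := [set w | exists2 k, _ & _].
have mS : measurable S.
  rewrite (_ : S = \bigcup_(k < m) [set w | norm2 (grad f (y k w)) < eps]) //.
  apply: bigcup_measurable => k _; apply: measurable_ltr; last exact: measurable_cst.
  exact/measurable_norm2/measurable_grad.
rewrite probE// lee_fin; have := probC Pr mS.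
suff : prob Pr (~` S) <= expR (- (delta ^+ 2 / 2 * q * m%:R)) by lra.
apply: le_trans tail; apply: prob_le; first exact: measurableC.
  rewrite (_ : [set _ | _] = \bigcup_(j in [set j : nat | j%:R < (1 - delta) * q * m%:R])
     [set w | hits E m w = j]); last first.
    apply/seteqP; split=> [w /= h|w [j jr /= ->]//]; by exists (hits E m w).
  by apply: bigcup_measurable => j _; exact: measurable_hits.
(* If no gradient is small, the hits pay for a decrease that [f] cannot afford. *)
move=> w /= nS.
have big k : (k < m)%N -> eps <= norm2 (grad f (y k w)).
  by move=> km; rewrite leNgt; apply/negP => lt; apply: nS; exists k.
have dec := decrease_ge_hits (X := X) hs hsn hf hgamma hc1 hc2 halpha hbeta hC heps hUH0
  (fun k => hUg k w) hUH big.
set pe := p_eps s n gamma c1 c2 alpha beta C Ug UH eps in dec hm.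
have pe0 : 0 < pe.
  by apply: p_eps_gt0 => //; [exact: leq_ltn_trans hsn|case: hC].
have fm : inf (f @` level_set f x0) <= f (y m w).
  apply: ge_inf; first by apply: level_set_lbound => //; exact: C2_continuous.
  by exists (y m w) => //; exact: iterate_level_set.
set Q := (f x0 - _) / _ in hm.
have Qm : Q < m%:R.
  by have /andP[_] := floor_itv Q; rewrite -hm.
have den0 : 0 < (1 - delta) * q * pe * eps ^+ 2.
  apply: mulr_gt0; last exact: exprn_gt0.
  by apply: mulr_gt0 => //; apply: mulr_gt0 => //; rewrite subr_gt0.
move: Qm; rewrite /Q ltr_pdivrMr// => Qm.
have pee : 0 < pe * eps ^+ 2 by rewrite mulr_gt0 ?exprn_gt0.
rewrite -(ltr_pM2r pee); apply: le_lt_trans dec _.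
apply: (@le_lt_trans _ _ (f x0 - inf (f @` level_set f x0))).
  by rewrite lerD2l lerN2.
by apply: lt_le_trans Qm _; rewrite le_eqVlt; apply/orP; left; apply/eqP; ring.
Qed.
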